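(* Let $\mathbf{M}_1$ be the set of isomorphism classes $[\mathscr{M}]$ of normalized bounded Lorentzian metric measure spaces $\mathscr{M}$. Then the quantity $\mathsf{L}\mathbf{\Delta}_0([\mathscr{M}],[\mathscr{M}']):=\mathsf{L}\mathbf{\Delta}_0(\mathscr{M},\mathscr{M}')$, where $\mathsf{L}\mathbf{\Delta}_0$ is the distortion distance, is a well-defined metric on $\mathbf{M}_1$ (in particular, it is independent of the chosen representatives).
   Context: A bounded Lorentzian metric space is a pair $(\mathsf{M},\tau)$ of a nonempty set $\mathsf{M}$ and a function $\tau\colon\mathsf{M}^2\to[0,\infty)$ such that: (a) $\tau(x,y)+\tau(y,z)\le\tau(x,z)$ whenever $\tau(x,y)>0$ and $\tau(y,z)>0$; (b) there is a topology $T$ on $\mathsf{M}$ such that $\tau$ is continuous for the product topology $T^2$ and $\{\tau\ge\varepsilon\}\subset\mathsf{M}^2$ is compact for every $\varepsilon>0$; (c) for all distinct $x,y\in\mathsf{M}$ there is $z\in\mathsf{M}$ with $\tau(x,z)\ne\tau(y,z)$ or $\tau(z,x)\neq\tau(z,y)$. All topological and Borel notions on $\mathsf{M}$ refer to the coarsest topology satisfying (b), which exists and is Polish. A normalized bounded Lorentzian metric measure space is a triple $\mathscr{M}=(\mathsf{M},\tau,\mathfrak{m})$ with $(\mathsf{M},\tau)$ a bounded Lorentzian metric space and $\mathfrak{m}$ a Borel probability measure on $\mathsf{M}$ (not necessarily of full support). Isomorphy. The spacelike boundary $i^0$ of a bounded Lorentzian metric space is the (unique, if it exists) point with $\tau(i^0,x)=\tau(x,i^0)=0$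 for every $x$. On $\mathrm{spt}\,\mathfrak{m}$ define $x\sim y$ if $\tau(x,z)=\tau(y,z)$ and $\tau(z,x)=\tau(z,y)$ for every $z\in\mathrm{spt}\,\mathfrak{m}$. Let $q\colon\mathrm{spt}\,\mathfrak{m}\to\tilde{\mathsf{M}}$ be the quotient projection and $\tilde\tau(q(x),q(y)):=\tau(x,y)$; then $(\tilde{\mathsf{M}},\tilde\tau)$ is a bounded Lorentzian metric space, and $\mathrm{spt}\,q_\sharp\mathfrak{m}=\tilde{\mathsf{M}}$, where $\sharp$ denotes push-forward. Write $\mathrm{spt}\,q_\sharp\mathfrak{m}\cup\{i^0\}$ for this space itself if it already has a spacelike boundary, and otherwise for the bounded Lorentzian metric space obtained by adjoining an abstract point $i^0$ and extending $\tilde\tau$ by zero to pairs involving $i^0$. Use primes for the analogous objects of $\mathscr{M}'$. $\mathscr{M}$ and $\mathscr{M}'$ are isomorphic if there is a Borel measurable map $\iota\colon\mathrm{spt}\,q_\sharp\mathfrak{m}\cup\{i^0\}\to\mathrm{spt}\,q'_\sharp\mathfrak{m}'\cup\{i'^0\}$ with $\tilde\tau(x,y)=\tilde\tau'(\iota(x),\iota(y))$ for all $x,y$ and $\iota_\sharp(q_\sharp\mathfrak{m})=q'_\sharp\mathfrak{m}'$. This is an equivalence relation. Distortion distance. $\mathsf{L}\mathbf{\Delta}_0(\mathscr{M},\mathscr{M}'):=\inf_\pi\inf\{\varepsilon>0:\pi^{\otimes2}[\{(x,x',y,y')\in(\mathsf{M}\times\mathsf{M}')^2:|\tau(x,y)-\tau'(x',y')|>\varepsilon\}]\le\varepsilon\}$,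 where $\pi$ ranges over all couplings of $\mathfrak{m}$ and $\mathfrak{m}'$ (Borel probability measures on $\mathsf{M}\times\mathsf{M}'$ with marginals $\mathfrak{m},\mathfrak{m}'$). *)

(* Defs.v *)
From HB Require Import structures.
From mathcomp Require Import all_boot all_order all_algebra generic_quotient.
From mathcomp Require Import all_classical all_reals all_analysis.

Set Implicit Arguments.
Unset Strict Implicit.
Unset Printing Implicit Defensive.

Import Order.TTheory GRing.Theory Num.Theory.
Import numFieldNormedType.Exports.

Local Open Scope classical_set_scope.
Local Open Scope ring_scope.

(* A topology as a first-class object, so that one can quantify over all the
   topologies of a given set; [topo_space T] is the corresponding library
   topological space. *)
Record topology (X : Type) := Topology {
  topo_open : set (set X);
  topo_openT : topo_open setT;
  topo_openI : setI_closed topo_open;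
  topo_open_bigU : forall (I : Type) (f : I -> set X),
    (forall i, topo_open (f i)) -> topo_open (\bigcup_i f i)
}.

Definition topo_space (X : Type) (T : topology X) : Type := X.

HB.instance Definition _ (X : choiceType) (T : topology X) :=
  Choice.on (topo_space T).
HB.instance Definition _ (X : choiceType) (T : topology X) :=
  isOpenTopological.Build (topo_space T)
    (@topo_openT X T) (@topo_openI X T) (@topo_open_bigU X T).
HB.instance Definition _ (X : pointedType) (T : topology X) :=
  Pointed.on (topo_space T).

Lemma topo_spaceE (X : choiceType) (T : topology X) :
  @open (topo_space T) = @topo_open X T.
Proof. by []. Qed.

HB.instance Definition _ (X Y : ptopologicalType) := Pointed.on (X * Y)%type.

Definition borel (X : ptopologicalType) := g_sigma_algebraType (@open X).

HB.instance Definition _ (X : ptopologicalType) := Measurable.on (borel X).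

Section time_separation.
Context (R : realType) (X : choiceType) (tau : X -> X -> R).

Definition reverse_triangle :=
  forall x y z, 0 < tau x y -> 0 < tau y z -> tau x y + tau y z <= tau x z.

Definition admissible (T : topology X) :=
  continuous (fun p : topo_space T * topo_space T => tau p.1 p.2) /\
  forall e : R, 0 < e ->
    compact [set p : topo_space T * topo_space T | e <= tau p.1 p.2].

Definition distinguishes :=
  forall x y, x <> y -> exists z, tau x z <> tau y z \/ tau z x <> tau z y.

Definition is_spacelike_boundary (p : X) :=
  forall x, tau p x = 0 /\ tau x p = 0.

Definition has_spacelike_boundary := exists p, is_spacelike_boundary p.

(* The infimum of all admissible topologies. For a bounded Lorentzian metric
   space it is itself admissible, hence the coarsest admissible topology. *)
Definition coarsest_open : set (set X) :=
  [set U | forall T : topology X, admissible T -> topo_open T U].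

Lemma coarsest_openT : coarsest_open setT.
Proof. by move=> T _; exact: topo_openT. Qed.

Lemma coarsest_openI : setI_closed coarsest_open.
Proof. by move=> A B oA oB T aT; apply: topo_openI; [exact: oA|exact: oB]. Qed.

Lemma coarsest_open_bigU (I : Type) (f : I -> set X) :
  (forall i, coarsest_open (f i)) -> coarsest_open (\bigcup_i f i).
Proof. by move=> of_ T aT; apply: topo_open_bigU => i; exact: of_. Qed.

Definition coarsest_topology : topology X :=
  Topology coarsest_openT coarsest_openI coarsest_open_bigU.

(* X together with an added point [None], the latter being dropped when X has
   a spacelike boundary already; in that case [in_i0] below is a bijection. *)
Definition with_i0 : Type :=
  {o : option X | `[< o = None -> ~ has_spacelike_boundary >]}.

HB.instance Definition _ := Choice.on with_i0.

Lemma in_i0_subproof (x : X) : `[< Some x = None -> ~ has_spacelike_boundary >].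
Proof. by apply/asboolP. Qed.

Definition in_i0 (x : X) : with_i0 := exist _ (Some x) (in_i0_subproof x).

Definition tau_i0 (a b : with_i0) : R :=
  if (val a, val b) is (Some x, Some y) then tau x y else 0.

Lemma tau_i0E x y : tau_i0 (in_i0 x) (in_i0 y) = tau x y.
Proof. by []. Qed.

Lemma with_i0_inhabited : inhabited with_i0.
Proof.
have [[p _]|noi0] := pselect has_spacelike_boundary.
  by constructor; exact: in_i0 p.
have h : `[< (None : option X) = None -> ~ has_spacelike_boundary >].
  by apply/asboolP.
by constructor; exact: exist _ None h.
Qed.

HB.instance Definition _ :=
  isPointed.Build with_i0 (inhabited_witness with_i0_inhabited).

Lemma with_i0_boundary :
  exists p : with_i0, forall x, tau_i0 p x = 0 /\ tau_i0 x p = 0.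
Proof.
have [[p p0]|noi0] := pselect has_spacelike_boundary.
  exists (in_i0 p) => -[[x|] ?]; rewrite /tau_i0 //=; exact: p0.
have h : `[< (None : option X) = None -> ~ has_spacelike_boundary >].
  by apply/asboolP.
by exists (exist _ None h) => -[[x|] ?]; rewrite /tau_i0 /=.
Qed.

Lemma in_i0_surj : has_spacelike_boundary -> forall a, exists x, a = in_i0 x.
Proof.
move=> hi0 [[x|] h]; first by exists x; exact: val_inj.
by move/asboolP: (h) => /(_ erefl).
Qed.

End time_separation.

Record blms (R : realType) := BLMS {
  blms_carrier :> pointedType;
  blms_tau : blms_carrier -> blms_carrier -> R;
  blms_tau_ge0 : forall x y, 0 <= blms_tau x y;
  blms_reverse_triangle : reverse_triangle blms_tau;
  blms_topology : exists T : topology blms_carrier, admissible blms_tau T;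
  blms_distinguishes : distinguishes blms_tau
}.

Definition blms_space (R : realType) (M : blms R) : ptopologicalType :=
  topo_space (coarsest_topology (@blms_tau R M)).

Record nblmms (R : realType) := NBLMMS {
  nblmms_space :> blms R;
  nblmms_measure : probability (borel (blms_space nblmms_space)) R
}.

Section isomorphy.
Context (R : realType) (M : nblmms R).

Local Notation tau := (@blms_tau R M).
Local Notation m := (@nblmms_measure R M).

Definition spt : set M :=
  [set x | forall U : set (blms_space M), open U -> U x -> (0 < m U)%E].

Definition spt_sim (x y : spt) : bool :=
  `[< forall z : spt, tau (val x) (val z) = tau (val y) (val z) /\
                      tau (val z) (val x) = tau (val z) (val y) >].

Lemma spt_sim_refl : reflexive spt_sim.
Proof. by move=> x; apply/asboolP. Qed.

Lemma spt_sim_sym : symmetric spt_sim.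
Proof.
by move=> x y; apply/asboolP/asboolP => h z; have [-> ->] := h z.
Qed.

Lemma spt_sim_trans : transitive spt_sim.
Proof.
move=> y x z /asboolP xy /asboolP yz; apply/asboolP => w.
by have [-> ->] := xy w; exact: yz.
Qed.

Canonical spt_sim_equiv :=
  EquivRel spt_sim spt_sim_refl spt_sim_sym spt_sim_trans.

Definition spt_quot : choiceType := {eq_quot spt_sim_equiv}%qT.

Definition spt_proj (x : spt) : spt_quot := (\pi x)%qT.

Definition quot_tau (a b : spt_quot) : R :=
  tau (val (repr (a : {eq_quot spt_sim_equiv}%qT)))
      (val (repr (b : {eq_quot spt_sim_equiv}%qT))).

Lemma quot_tauE (x y : spt) :
  quot_tau (spt_proj x) (spt_proj y) = tau (val x) (val y).
Proof.
rewrite /quot_tau /spt_proj.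
have simr (z : spt) : spt_sim (repr (\pi z : {eq_quot spt_sim_equiv})%qT) z.
  by have /eqmodP := reprK (\pi z : {eq_quot spt_sim_equiv})%qT.
have /asboolP hx := simr x; have /asboolP hy := simr y.
by rewrite (hx _).1 (hy _).2.
Qed.

Definition model : Type := with_i0 quot_tau.
HB.instance Definition _ := Pointed.on model.

Definition model_tau : model -> model -> R := @tau_i0 R spt_quot quot_tau.

Definition model_space : ptopologicalType :=
  topo_space (coarsest_topology model_tau).

(* q_# m, as a measure on the space with i^0. Since m is concentrated on its
   support, the preimage under q : spt m -> spt_quot is seen as a subset of M. *)
Definition model_measure (B : set (borel model_space)) : \bar R :=
  m [set val x | x in [set x : spt | B (in_i0 quot_tau (spt_proj x))]].

End isomorphy.

Definition isomorphic (R : realType) (M M' : nblmms R) : Prop :=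
  exists iota : borel (model_space M) -> borel (model_space M'),
    [/\ measurable_fun setT iota,
        forall x y, model_tau x y = model_tau (iota x) (iota y) &
        forall B, measurable B ->
          pushforward (@model_measure R M) iota B = @model_measure R M' B].

Section distortion.
Context (R : realType) (M M' : nblmms R).

Local Notation prodM := (borel (blms_space M * blms_space M')%type).

Definition coupling (pi : probability prodM R) : Prop :=
  (forall A : set (borel (blms_space M)), measurable A ->
     pushforward pi (fst : prodM -> borel (blms_space M)) A =
     nblmms_measure M A) /\
  (forall A : set (borel (blms_space M')), measurable A ->
     pushforward pi (snd : prodM -> borel (blms_space M')) A =
     nblmms_measure M' A).

Definition distortion_gt (e : R) : set (prodM * prodM) :=
  [set p | e < `| @blms_tau R M p.1.1 p.2.1 - @blms_tau R M' p.1.2 p.2.2 |].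

Definition coupling_distortion (pi : probability prodM R) : \bar R :=
  ereal_inf [set e%:E | e in
    [set e : R | 0 < e /\ ((pi \x pi) (distortion_gt e) <= e%:E)%E]].

Definition distortion_distance : \bar R :=
  ereal_inf [set coupling_distortion pi | pi in coupling].

End distortion.

(* Classes are predicates rather than library sets, and a dedicated record
   rather than a [sig] type, because of universe constraints: nblmms R lives in
   the universe above that of the carriers. *)
Definition iso_class (R : realType) (M : nblmms R) : nblmms R -> Prop :=
  fun N => isomorphic M N.

Record iso_classes (R : realType) := IsoClasses {
  iso_classes_mem : nblmms R -> Prop;
  iso_classesP : exists M, iso_classes_mem = iso_class M
}.

Definition class_of (R : realType) (M : nblmms R) : iso_classes R :=
  IsoClasses (ex_intro _ M erefl).

Definition is_metric (R : realType) (X : Type) (d : X -> X -> R) : Prop :=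
  [/\ forall x y, 0 <= d x y,
      forall x y, d x y = 0 <-> x = y,
      forall x y, d x y = d y x &
      forall x y z, d x z <= d x y + d y z].

(* Main.v *)
(* A coarse gluing replaces disintegration in the triangle inequality: the
   middle space is cut into finitely many cells on whose products its time
   separation is nearly constant off a small set, and the two couplings are
   made conditionally independent given the cell of the middle point.

   A space M is at distance zero from its model, through the coupling
   supported by the graph of the quotient projection; hence so are isomorphic
   spaces. The quotient is admissible because its initial topology for
   countably many functions tau(z, _), tau(_, z) is Hausdorff and agrees with
   the quotient topology on the compact sets off the spacelike boundary; that
   initial topology is then the coarsest one, and it is second countable.

   Conversely, no optimal coupling is needed at distance zero. Take couplings
   pi_n of the models with distortion at most 1/(n+1) and an ultrafilter on
   nat, and relate x and x' when the pi_n-mass of no product of neighbourhoods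
   tends to 0. Products of masses bound the distortion from below, so the
   relation preserves tau; local compactness off the boundary and tightness
   make it total both ways, hence the graph of an isometry iota. The pi_n
   concentrate on this graph, so iota transports the measures. *)
Require Import Defs.
From HB Require Import structures.
From mathcomp Require Import all_boot all_order all_algebra.
From mathcomp Require Import all_classical all_reals all_analysis.
From mathcomp Require Import measurable_realfun ring lra.

Import Order.TTheory GRing.Theory Num.Theory.
Local Open Scope classical_set_scope.
Local Open Scope ring_scope.

Set Implicit Arguments.
Unset Strict Implicit.
Unset Printing Implicit Defensive.
Import numFieldNormedType.Exports.

(** The obstacle is topological. An admissible topology need not be second countable, and the
    coarsest one is defined as an intersection, from which neither its open sets nor its own
    admissibility can be read off. The measure theory rests on a countable base: it gives the
    support full mass, makes open sets of a product measurable for the product sigma-algebra, and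
    lets countably many rectangles control [tau]. This is why an explicit base of rational boxes is
    built and shown to describe the coarsest topology.

    The ultrafilter serves to synchronise lower bounds: a set that is not null has mass bounded
    below along a set of indices in the ultrafilter, and two such index sets meet, so that two
    masses can be multiplied at one index and compared with the distortion there.

    The spacelike boundary needs separate care. An adjoined boundary point carries no mass, so the
    limit relation is shown to be total only off the boundary, and boundary points are matched by
    hand. Conversely, comparing points against nonboundary points only is enough to tell them
    apart. *)

Lemma measurable_preimageT d d' (T : measurableType d) (T' : measurableType d')
    (f : T -> T') (A : set T') :
  measurable_fun setT f -> measurable A -> measurable (f @^-1` A).
Proof. by move=> mf mA; rewrite -[X in measurable X]setTI; exact: mf. Qed.

Lemma pushforward_probability d d' (T : measurableType d)
    (T' : measurableType d') (R : realType) (P : probability T R)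
    (f : T -> T') :
  measurable_fun setT f ->
  exists Q : probability T' R, forall A, Q A = P (f @^-1` A).
Proof. by move=> mf; exists (distribution P (mfun_Sub (mem_set mf))). Qed.

(** * Estimates and finite partitions for probability measures *)

Section probability_facts.
Context d (T : measurableType d) (R : realType).
Implicit Type P : probability T R.

Lemma probability_subU_le P (E A B : set T) (a b : \bar R) :
  measurable E -> measurable A -> measurable B -> E `<=` A `|` B ->
  (P A <= a)%E -> (P B <= b)%E -> (P E <= a + b)%E.
Proof.
move=> mE mA mB EAB Pa Pb.
apply: (@le_trans _ _ (P (A `|` B))).
  by apply: le_measure => //; rewrite inE//; exact: measurableU.
by apply: le_trans (leeD Pa Pb); exact: measureU2.
Qed.

Lemma probability_exhaustion P (A : nat -> set T) :
  (forall n, measurable (A n)) -> nondecreasing_seq A ->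
  \bigcup_n A n = setT ->
  forall e : R, 0 < e -> exists n, (P (~` A n) < e%:E)%E.
Proof.
move=> mA ndA UA e e0.
have : P \o A @ \oo --> 1%E.
  rewrite -(probability_setT P) -UA; apply: nondecreasing_cvg_mu => //.
  exact: bigcupT_measurable.
move=> /fine_cvgP[_ /cvgrPdist_lt /(_ e e0)] [n _ h].
exists n; rewrite probability_setC//.
have fA : P (A n) \is a fin_num by exact: fin_num_measure.
rewrite -(fineK fA) -EFinB lte_fin.
by apply: le_lt_trans (h n (leqnn n)); rewrite /= ler_norm.
Qed.

(** Both sides agree on rectangles, which determine a product measure. Asking only that [Q] agree
    with the push-forward on measurable sets lets the lemma apply to marginals of a glued coupling
    as well. *)
Lemma product_pushforward d' (T' : measurableType d') (P : probability T R)
    (Q : probability T' R) (f : T -> T') : measurable_fun setT f ->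
  (forall A, measurable A -> Q A = P (f @^-1` A)) ->
  forall E : set (T' * T'), measurable E ->
  (Q \x Q)%E E = (P \x P)%E [set p | E (f p.1, f p.2)].
Proof.
move=> mf QE E mE.
have mff : measurable_fun setT (fun p : T * T => (f p.1, f p.2)).
  by apply/measurable_fun_pair => /=; apply: measurableT_comp.
have [PP PPE] := pushforward_probability ((P \x P)%E : probability _ _) mff.
rewrite (product_measure_unique (m' := PP))//; first exact: PPE.
move=> A B mA mB; rewrite [X in (X * _)%E]QE// [X in (_ * X)%E]QE// [LHS]PPE.
by rewrite -product_measure1E//; rewrite -[X in measurable X]setTI; exact: mf.
Qed.

Lemma probability_partition P (c : T -> nat) N A : measurable A ->
  (forall x, (c x < N)%N) -> (forall k, measurable (c @^-1` [set k])) ->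
  (\sum_(k < N) P (A `&` c @^-1` [set k : nat]))%E = P A.
Proof.
move=> mA cN mc; have mAc k : measurable (A `&` c @^-1` [set k]).
  exact: measurableI.
rewrite -(@measure_semi_additive_ord_I _ _ _ P
  (fun k => A `&` c @^-1` [set k]))//.
- congr (P _).
  rewrite -(bigcup_mkord N (fun k => A `&` c @^-1` [set k])); apply/seteqP; split.
    by move=> x [k _] [].
  by move=> x Ax; exists (c x) => //=.
- apply/trivIsetP => i j _ _ /eqP ij; apply/seteqP; split => // x /=.
  by case=> -[_ ci] [_ cj]; apply: ij; rewrite -ci -cj.
- rewrite -(bigcup_mkord N (fun k => A `&` c @^-1` [set k])).
  exact: bigcup_measurable.
Qed.

(* The codes of the points record their memberships, hence the exponentially
   many cells. *)
Lemma measurable_coding (A : nat -> set T) n :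
  (forall i, measurable (A i)) ->
  exists (c : T -> nat) (N : nat),
    [/\ forall x, (c x < N)%N, forall k, measurable (c @^-1` [set k]) &
        forall x y, c x = c y -> forall i, (i < n)%N -> A i x -> A i y].
Proof.
move=> mA; elim: n => [|n [c [N [cN mc cA]]]].
  exists (fun=> 0%N), 1%N; split => // k.
  have [->|k0] := eqVneq k 0%N.
    by rewrite (_ : _ @^-1` _ = setT)//; apply/seteqP; split.
  rewrite (_ : _ @^-1` _ = set0)//; apply/seteqP; split => // x /= k0'.
  by rewrite -k0' eqxx in k0.
exists (fun x => if `[< A n x >] then c x + N else c x)%N, (N + N)%N; split.
- by move=> x; case: ifP => _; rewrite ?ltn_add2r ?ltn_addr.
- move=> k; have [Nk|kN] := leqP N k.
  + rewrite (_ : _ @^-1` _ = A n `&` (c @^-1` [set (k - N)%N])).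
      exact: measurableI.
    apply/seteqP; split => x /=.
      case: asboolP => [Ax <-|_ ck]; first by rewrite addnK.
      by have := cN x; rewrite ck ltnNge Nk.
    by case=> Ax ->; case: asboolP => // _; rewrite subnK.
  + rewrite (_ : _ @^-1` _ = ~` A n `&` (c @^-1` [set k])).
      by apply: measurableI => //; exact: measurableC.
    apply/seteqP; split => x /=.
      by case: asboolP => // Ax ck; move: kN; rewrite -ck ltnNge leq_addl.
    by case=> Ax ->; case: asboolP.
- move=> x y + i; rewrite ltnS leq_eqVlt => + /orP[/eqP->|ni].
    case: asboolP => // Ax; case: asboolP => // Ay cxy.
    by have := cN y; rewrite -cxy ltnNge leq_addl.
  case: asboolP => Ax; case: asboolP => Ay cxy; last exact: cA.
  + by apply: cA ni => //; apply/eqP; rewrite -(eqn_add2r N) cxy.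
  + by have := cN y; rewrite -cxy ltnNge leq_addl.
  + by have := cN x; rewrite cxy ltnNge leq_addl.
Qed.

End probability_facts.

(** * Couplings of small distortion and their gluing *)

Section coupled.
Context (R : realType).

(** The coupling lives on the product sigma-algebra, where rectangles determine measures. The
    passage to and from Borel sets of the product topology is left to [coupling_coupled] and
    [coupled_coupling]. *)
Definition coupled (e : R) d1 d2 (T1 : measurableType d1)
    (T2 : measurableType d2) (P1 : probability T1 R) (t1 : T1 -> T1 -> R)
    (P2 : probability T2 R) (t2 : T2 -> T2 -> R) :=
  exists pi : probability (T1 * T2)%type R,
    [/\ forall A, measurable A -> pi (fst @^-1` A) = P1 A,
        forall B, measurable B -> pi (snd @^-1` B) = P2 B &
        ((pi \x pi) [set p | (e < `|t1 p.1.1 p.2.1 - t2 p.1.2 p.2.2|)%R]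
          <= e%:E)%E].

(** All that gluing requires of the middle space: a measure-theoretic trace of a continuous function
    on a second countable space. *)
Definition rect_approx d (T : measurableType d) (t : T -> T -> R) :=
  forall e : R, 0 < e -> exists A B : nat -> set T,
    [/\ forall n, measurable (A n), forall n, measurable (B n),
        forall x y, exists n, A n x /\ B n y &
        forall n x y x' y', A n x -> A n x' -> B n y -> B n y' ->
          `|t x y - t x' y'| <= e].

Lemma measurable_distortion d d1 d2 (T : measurableType d)
    (T1 : measurableType d1) (T2 : measurableType d2)
    (t1 : T1 -> T1 -> R) (t2 : T2 -> T2 -> R) (f g : T -> T1) (f' g' : T -> T2)
    (e : R) :
  measurable_fun setT (fun p : T1 * T1 => t1 p.1 p.2) ->
  measurable_fun setT (fun p : T2 * T2 => t2 p.1 p.2) ->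
  measurable_fun setT f -> measurable_fun setT g ->
  measurable_fun setT f' -> measurable_fun setT g' ->
  measurable [set x | e < `|t1 (f x) (g x) - t2 (f' x) (g' x)|].
Proof.
move=> m1 m2 mf mg mf' mg'.
have h1 : measurable_fun setT (fun x => t1 (f x) (g x)).
  by apply: (measurableT_comp m1 (g := fun x => (f x, g x)));
    exact: measurable_fun_pair.
have h2 : measurable_fun setT (fun x => t2 (f' x) (g' x)).
  by apply: (measurableT_comp m2 (g := fun x => (f' x, g' x)));
    exact: measurable_fun_pair.
have h : measurable_fun setT (fun x => `|t1 (f x) (g x) - t2 (f' x) (g' x)|).
  by apply: measurableT_comp => //; exact: measurable_funB.
rewrite (_ : [set _ | _] = setT `&`
  (fun x => `|t1 (f x) (g x) - t2 (f' x) (g' x)|) @^-1` `]e, +oo[%classic).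
  exact: h.
by rewrite setTI; apply/seteqP; split => x; rewrite /= in_itv /= andbT.
Qed.

Lemma coupled_sym e d1 d2 (T1 : measurableType d1)
    (T2 : measurableType d2) (P1 : probability T1 R) (t1 : T1 -> T1 -> R)
    (P2 : probability T2 R) (t2 : T2 -> T2 -> R) :
  measurable_fun setT (fun p : T1 * T1 => t1 p.1 p.2) ->
  measurable_fun setT (fun p : T2 * T2 => t2 p.1 p.2) ->
  coupled e P1 t1 P2 t2 -> coupled e P2 t2 P1 t1.
Proof.
move=> m1 m2 [pi [piA piB pie]].
have msw : measurable_fun setT (fun p : T1 * T2 => (p.2, p.1)).
  exact: measurable_fun_pair.
have [pi' pi'E] := pushforward_probability pi msw.
exists pi'; split => [A mA|A mA|]; rewrite ?pi'E; [exact: piB|exact: piA|].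
rewrite (product_pushforward (P := pi) msw)//.
  apply: le_trans pie; rewrite le_eqVlt; apply/orP; left; apply/eqP.
  by congr (_ _); apply/seteqP; split => p /=; rewrite distrC.
by apply: measurable_distortion => //; apply: measurableT_comp.
Qed.

(** The push-forward of [P1] to the graph of [f] has no distortion over [S * S]. The set [S] of full
    mass is there for the quotient projection, which is isometric on the support only. *)
Lemma coupled_graph d1 d2 (T1 : measurableType d1)
    (T2 : measurableType d2) (P1 : probability T1 R) (t1 : T1 -> T1 -> R)
    (P2 : probability T2 R) (t2 : T2 -> T2 -> R) (f : T1 -> T2) (S : set T1) :
  measurable_fun setT (fun p : T1 * T1 => t1 p.1 p.2) ->
  measurable_fun setT (fun p : T2 * T2 => t2 p.1 p.2) ->
  measurable_fun setT f -> measurable S -> P1 S = 1%E ->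
  (forall x y, S x -> S y -> t1 x y = t2 (f x) (f y)) ->
  (forall B, measurable B -> P2 B = P1 (f @^-1` B)) ->
  forall e, 0 < e -> coupled e P1 t1 P2 t2.
Proof.
move=> m1 m2 mf mS PS tf P2E e e0.
have mg : measurable_fun setT (fun x => (x, f x)) by exact: measurable_fun_pair.
have [pi piE] := pushforward_probability P1 mg.
exists pi; split => [A mA|B mB|]; rewrite ?piE// ?P2E//.
rewrite (product_pushforward (P := P1) mg)//=; last first.
  by apply: measurable_distortion => //; apply: measurableT_comp.
have mSC : measurable (~` S) by exact: measurableC.
have PSC : P1 (~` S) = 0%E by rewrite probability_setC// PS subee.
apply: (@le_trans _ _ (0 + 0)%E); last by rewrite adde0 lee_fin ltW.
apply: (@probability_subU_le _ _ _ _ _ (~` S `*` setT) (setT `*` ~` S)).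
- by apply: measurable_distortion => //; exact: measurableT_comp.
- exact: measurableX.
- exact: measurableX.
- move=> [x y] /= h; have [Sx|nSx] := pselect (S x); last by left.
  have [Sy|nSy] := pselect (S y); last by right.
  by move: h; rewrite tf// subrr normr0 ltNge (ltW e0).
- by rewrite [leLHS]product_measure1E// [X in (X * _)%E]PSC mul0e.
- by rewrite [leLHS]product_measure1E// [X in (_ * X)%E]PSC mule0.
Qed.

(** The measure is the sum over [k] of [p12 \x p23] restricted to [F k * G k] and divided by
    [P2 (C k)]. Integrating out either factor produces [P2 (C k)], which cancels the weight, so both
    marginals are exact. The two middle points may differ but share their cell. *)
Lemma glued_coupling d1 d2 d3 (T1 : measurableType d1) (T2 : measurableType d2)
    (T3 : measurableType d3) (P2 : probability T2 R)
    (p12 : probability (T1 * T2)%type R) (p23 : probability (T2 * T3)%type R)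
    (c : T2 -> nat) (N : nat) :
  (forall B, measurable B -> p12 (snd @^-1` B) = P2 B) ->
  (forall B, measurable B -> p23 (fst @^-1` B) = P2 B) ->
  (forall x, (c x < N)%N) -> (forall k, measurable (c @^-1` [set k])) ->
  exists rho : probability ((T1 * T2) * (T2 * T3))%type R,
    [/\ forall A, measurable A -> rho (fst @^-1` A) = p12 A,
        forall A, measurable A -> rho (snd @^-1` A) = p23 A &
        rho [set p | c p.1.2 <> c p.2.1] = 0%E].
Proof.
move=> m12 m23 cN mc.
pose C k := c @^-1` [set k].
pose F k : set (T1 * T2) := snd @^-1` C k.
pose G k : set (T2 * T3) := fst @^-1` C k.
have mF k : measurable (F k) by apply: measurable_preimageT => //; exact: mc.
have mG k : measurable (G k) by apply: measurable_preimageT => //; exact: mc.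
have mFG k : measurable (F k `*` G k) by exact: measurableX.
pose w k : {nonneg R} := 
  NngNum (etrans (invr_ge0 _) (fine_ge0 (measure_ge0 P2 (C k)))).
pose rho_ k : {measure set _ -> \bar R} :=
  mscale (w k) (mrestr (p12 \x p23)%E (mFG k)).
pose rho := msum rho_ N.
have rhoE A : rho A =
    (\sum_(k < N) (fine (P2 (C k)))^-1%:E * (p12 \x p23) (A `&` F k `*` G k))%E.
  by [].
have finC k : P2 (C k) \is a fin_num by apply: fin_num_measure; exact: mc.
(* In a null cell the weight is [0^-1 = 0]; the identity survives because [x] is then squeezed to
   0. *)
have wE k (x : \bar R) : (0 <= x <= P2 (C k))%E ->
    ((fine (P2 (C k)))^-1%:E * (x * P2 (C k)))%E = x.
  have [P0|P0] := eqVneq (P2 (C k)) 0%E.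
    by rewrite P0 => /le_anti <-; rewrite !mule0.
  move=> /andP[x0 xP].
  have fx : x \is a fin_num.
    by rewrite ge0_fin_numE// (le_lt_trans xP)// ltey_eq finC.
  rewrite -(fineK (finC k)) -(fineK fx) -!EFinM mulrCA mulVf ?mulr1//.
  by apply: contra P0 => /eqP /= h; rewrite -(fineK (finC k)) h.
have rho1 A : measurable A -> rho (fst @^-1` A) = p12 A.
  move=> mA; rewrite rhoE.
  rewrite -(@probability_partition _ _ _ p12 (c \o snd) N _ mA
    (fun x => cN x.2) mF)//.
  apply: eq_bigr => k _; rewrite (_ : _ `&` _ = (A `&` F k) `*` G k); last first.
    by apply/seteqP; split => -[u v] /=; tauto.
  have mAF : measurable (A `&` F k) by exact: measurableI.
  rewrite product_measure1E// [X in (_ * (_ * X))%E]m23; last exact: mc.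
  rewrite wE// measure_ge0/= -m12; last exact: mc.
  apply: le_measure; [exact/mem_set|apply/mem_set; exact: mF|exact: subIsetr].
have rho2 A : measurable A -> rho (snd @^-1` A) = p23 A.
  move=> mA; rewrite rhoE.
  rewrite -(@probability_partition _ _ _ p23 (c \o fst) N _ mA
    (fun x => cN x.1) mG)//.
  apply: eq_bigr => k _; rewrite (_ : _ `&` _ = F k `*` (A `&` G k)); last first.
    by apply/seteqP; split => -[u v] /=; tauto.
  have mAG : measurable (A `&` G k) by exact: measurableI.
  rewrite product_measure1E// [X in (_ * (X * _))%E]m12; last exact: mc.
  rewrite [X in (_ * X)%E]muleC wE// measure_ge0/= -m23; last exact: mc.
  apply: le_measure; [exact/mem_set|apply/mem_set; exact: mG|exact: subIsetr].
have rhoT : rho setT = 1%E by rewrite -(probability_setT p12) -rho1.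
pose rhoP := HB.pack_for (probability _ R) rho
  (Measure_isProbability.Build _ _ _ rho rhoT).
exists rhoP; split; [exact: rho1|exact: rho2|].
change (rho [set p | c p.1.2 <> c p.2.1] = 0%E).
rewrite rhoE big1// => k _; rewrite (_ : _ `&` _ = set0) ?measure0 ?mule0//.
by apply/seteqP; split => // -[u v] /= [cuv [Fu Gv]]; apply: cuv; rewrite Fu Gv.
Qed.

(** Off small sets, [t1 x1 y1 - t3 x3 y3] splits into the distortion of [p12], that of [p23], and
    the change of [t2] between two pairs of middle points in the same cells. The last is at most
    [e], since the cells refine finitely many rectangles that cover all but mass [e]. So [a + b + e]
    bounds the values and the exceptional mass alike. *)
Lemma coupled_trans d1 d2 d3 (T1 : measurableType d1) (T2 : measurableType d2)
    (T3 : measurableType d3) (P1 : probability T1 R) (t1 : T1 -> T1 -> R)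
    (P2 : probability T2 R) (t2 : T2 -> T2 -> R)
    (P3 : probability T3 R) (t3 : T3 -> T3 -> R) (a b e : R) :
  measurable_fun setT (fun p : T1 * T1 => t1 p.1 p.2) ->
  measurable_fun setT (fun p : T2 * T2 => t2 p.1 p.2) ->
  measurable_fun setT (fun p : T3 * T3 => t3 p.1 p.2) ->
  rect_approx t2 -> 0 < e ->
  coupled a P1 t1 P2 t2 -> coupled b P2 t2 P3 t3 ->
  coupled (a + b + e) P1 t1 P3 t3.
Proof.
move=> m1 m2 m3 t2e e0 [p12 [p12A p12B p12e]] [p23 [p23A p23B p23e]].
have [A [B [mA mB AB te]]] := t2e _ e0.
pose W n := \bigcup_(i < n) (A i `*` B i).
have mW n : measurable (W n).
  by apply: bigcup_measurable => i _; exact: measurableX.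
have [n Wn] : exists n, ((P2 \x P2) (~` W n) < e%:E)%E.
  apply: (@probability_exhaustion _ _ _ (P2 \x P2)%E) => //.
  - move=> i j ij; apply/subsetPset => -[x y] [k /= ki xy]; exists k => //=.
    exact: leq_trans ki ij.
  - apply/seteqP; split => // -[x y] _; have [k xy] := AB x y.
    by exists k.+1 => //; exists k => /=.
(* Interleaved with [B] at even and [A] at odd places, so that one coding of the first [n.*2.+1]
   sets respects every [A i] and [B i] with [i < n]. *)
pose D i := if odd i then A i./2 else B i./2.
have mD i : measurable (D i) by rewrite /D; case: ifP.
have [c [N [cN mc cD]]] := measurable_coding n.*2.+1 mD.
have cA x y i : c x = c y -> (i < n)%N -> A i x -> A i y.
  move=> cxy ni; have := cD x y cxy i.*2.+1; rewrite /D /= odd_double /=.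
  by rewrite uphalf_double ltnS ltn_double; exact.
have cB x y i : c x = c y -> (i < n)%N -> B i x -> B i y.
  move=> cxy ni; have := cD x y cxy i.*2; rewrite /D /= odd_double /=.
  by rewrite doubleK ltnS leq_double; apply; exact: ltnW.
have [rho [rho1 rho2 rhoc]] := glued_coupling p12B p23A cN mc.
have mf : measurable_fun setT
    (fun p : (T1 * T2) * (T2 * T3) => (p.1.1, p.2.2)).
  by apply: measurable_fun_pair; exact: measurableT_comp.
have [p13 p13E] := pushforward_probability rho mf.
exists p13; split => [E mE|E mE|].
- rewrite p13E -p12A// -rho1//; exact: measurable_preimageT.
- rewrite p13E -p23B// -rho2//; exact: measurable_preimageT.
rewrite (product_pushforward (P := rho) mf)//=; last first.
  by apply: measurable_distortion => //; exact: measurableT_comp.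
have mc12 : measurable [set p : (T1 * T2) * (T2 * T3) | c p.1.2 <> c p.2.1].
  rewrite (_ : [set _ | _] = ~` \bigcup_k
      ((fun p : (T1 * T2) * (T2 * T3) => p.1.2) @^-1` (c @^-1` [set k]) `&`
       (fun p : (T1 * T2) * (T2 * T3) => p.2.1) @^-1` (c @^-1` [set k]))).
    apply: measurableC; apply: bigcup_measurable => k _.
    by apply: measurableI; apply: measurable_preimageT => //;
      exact: measurableT_comp.
  apply/seteqP; split => p /=; first by move=> h [k _ [/= h1 h2]]; rewrite h1 h2 in h.
  by move=> h cp; apply: h; exists (c p.1.2).
(* One summand per exceptional set: large distortion of [p12], large distortion of [p23], middle
   pair outside [W n], and middle points in different cells for the first or the second factor. *)
rewrite [leRHS](_ : _ = (a%:E + (b%:E + (e%:E + (0 + 0)))))%E; last first.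
  by rewrite !adde0 !EFinD addeA.
pose E1 : set _ := [set p : ((T1 * T2) * (T2 * T3)) * ((T1 * T2) * (T2 * T3)) |
  a < `|t1 p.1.1.1 p.2.1.1 - t2 p.1.1.2 p.2.1.2|].
pose E2 : set _ := [set p : ((T1 * T2) * (T2 * T3)) * ((T1 * T2) * (T2 * T3)) |
  b < `|t2 p.1.2.1 p.2.2.1 - t3 p.1.2.2 p.2.2.2|].
pose E3 : set _ := [set p : ((T1 * T2) * (T2 * T3)) * ((T1 * T2) * (T2 * T3)) |
  ~ W n (p.1.1.2, p.2.1.2)].
pose E0 := [set p : (T1 * T2) * (T2 * T3) | c p.1.2 <> c p.2.1].
have mE1 : measurable E1.
  by apply: measurable_distortion => //; do 2!apply: measurableT_comp => //.
have mE2 : measurable E2.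
  by apply: measurable_distortion => //; do 2!apply: measurableT_comp => //.
have mp12 : measurable_fun setT (fun p : (T1 * T2) * (T2 * T3) => p.1.2).
  exact: measurableT_comp.
have mE3 : measurable E3.
  apply: (measurable_preimageT (f := fun p : ((T1 * T2) * (T2 * T3)) *
    ((T1 * T2) * (T2 * T3)) => (p.1.1.2, p.2.1.2)) (A := ~` W n)).
    by apply: measurable_fun_pair; exact: (measurableT_comp mp12).
  exact: measurableC.
have mE0T : measurable (E0 `*` [set: (T1 * T2) * (T2 * T3)]).
  exact: measurableX.
have mTE0 : measurable ([set: (T1 * T2) * (T2 * T3)] `*` E0).
  exact: measurableX.
have mU0 := measurableU _ _ mE0T mTE0.
have mU3 := measurableU _ _ mE3 mU0.
have mU2 := measurableU _ _ mE2 mU3.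
apply: (@probability_subU_le _ _ _ _ _ E1 (E2 `|` (E3 `|`
   (E0 `*` setT `|` setT `*` E0)))) => //.
- by apply: measurable_distortion => //; do 2!apply: measurableT_comp => //.
- move=> [[[x1 x2] [x2' x3]] [[y1 y2] [y2' y3]]] /= h.
  have [h0|/contrapT cx] := pselect (c x2 <> c x2'); first by do 3!right; left.
  have [h0|/contrapT cy] := pselect (c y2 <> c y2'); first by do 4!right.
  have [h0|/contrapT [i /= ni [Ax By]]] := pselect (~ W n (x2, y2)).
    by do 2!right; left.
  have h2 := te _ _ _ _ _ Ax (cA _ _ _ cx ni Ax) By (cB _ _ _ cy ni By).
  have [h1|h1] := ltP a `|t1 x1 y1 - t2 x2 y2|; first by left.
  have [h3|h3] := ltP b `|t2 x2' y2' - t3 x3 y3|; first by right; left.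
  exfalso; move: h; rewrite ltNge => /negP; apply.
  rewrite (_ : t1 x1 y1 - t3 x3 y3 = (t1 x1 y1 - t2 x2 y2) +
    (t2 x2' y2' - t3 x3 y3) + (t2 x2 y2 - t2 x2' y2')); last first.
    by ring.
  by rewrite (le_trans (ler_normD _ _))// lerD// (le_trans (ler_normD _ _))// lerD.
- apply: le_trans p12e.
  rewrite (product_pushforward (P := rho) (f := fst))//.
    by move=> E mE; rewrite rho1.
  by apply: measurable_distortion => //; exact: measurableT_comp.
apply: (@probability_subU_le _ _ _ _ _ E2 (E3 `|`
   (E0 `*` setT `|` setT `*` E0))) => //.
  apply: le_trans p23e.
  rewrite (product_pushforward (P := rho) (f := snd))//.
    by move=> E mE; rewrite rho2.
  by apply: measurable_distortion => //; exact: measurableT_comp.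
apply: (@probability_subU_le _ _ _ _ _ E3 (E0 `*` setT `|` setT `*` E0)) => //.
  apply: le_trans (ltW Wn).
  rewrite (product_pushforward (P := rho) mp12)//; last exact: measurableC.
  move=> E mE; rewrite -p12B// -rho1//; exact: measurable_preimageT.
apply: (@probability_subU_le _ _ _ _ _ (E0 `*` setT) (setT `*` E0)) => //.
- by rewrite [leLHS]product_measure1E// [X in (X * _)%E]rhoc mul0e.
- by rewrite [leLHS]product_measure1E// [X in (_ * X)%E]rhoc mule0.
Qed.

End coupled.

(** * The coarsest admissible topology *)

Lemma hausdorff_of_separating (R : realType) (T : topologicalType) (I : Type)
    (f : I -> T -> R) :
  (forall i, continuous (f i)) ->
  (forall x y, (forall i, f i x = f i y) -> x = y) -> hausdorff_space T.
Proof.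
move=> fc fsep p q clpq; apply: fsep => i; apply: Rhausdorff => A B Ap Bq.
have [x [Ax Bx]] := clpq _ _ (fc i p _ Ap) (fc i q _ Bq).
by exists (f i x).
Qed.

Lemma pairl_continuous (Y Z : topologicalType) (y : Y) :
  continuous (fun z : Z => (y, z)).
Proof. by move=> z; apply: cvg_pair; [exact: cvg_cst|exact: cvg_id]. Qed.

Lemma pairr_continuous (Y Z : topologicalType) (z : Z) :
  continuous (fun y : Y => (y, z)).
Proof. by move=> y; apply: cvg_pair; [exact: cvg_id|exact: cvg_cst]. Qed.

Section box_topology.
Context (R : realType) (I : countType) (X : choiceType) (F : I -> X -> R).

(** Indexing by lists over a countable type makes the base of the initial topology of the [F i]
    countable by construction. *)
Definition box (l : seq (I * rat * rat)) : set X :=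
  [set x | forall p, p \in l -> ratr p.1.2 < F p.1.1 x < ratr p.2].

Definition closed_box (l : seq (I * rat * rat)) : set X :=
  [set x | forall p, p \in l -> ratr p.1.2 <= F p.1.1 x <= ratr p.2].

Lemma box_nil : box [::] = setT.
Proof. by apply/seteqP; split. Qed.

Lemma box_cons p l :
  box (p :: l) = [set x | ratr p.1.2 < F p.1.1 x < ratr p.2] `&` box l.
Proof.
apply/seteqP; split => x /=.
  by move=> h; split => [|r rl]; apply: h; rewrite inE ?eqxx ?rl ?orbT.
by case=> h h' r; rewrite inE => /orP[/eqP->//|]; exact: h'.
Qed.

Lemma box_cat l l' : box (l ++ l') = box l `&` box l'.
Proof.
apply/seteqP; split => x /=.
  by move=> h; split => r rl; apply: h; rewrite mem_cat rl ?orbT.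
by case=> h h' r; rewrite mem_cat => /orP[]; [exact: h|exact: h'].
Qed.

Lemma box_closed_box l : box l `<=` closed_box l.
Proof. by move=> x h p /h /andP[/ltW -> /ltW ->]. Qed.

(** Regularity at the level of boxes. It gives the last clause of [lorentzian] and the approximation
    of open sets by closed subsets. *)
Lemma box_shrink l x : box l x -> exists2 l', box l' x & closed_box l' `<=` box l.
Proof.
elim: l => [_|p l IH]; first by exists [::] => //; rewrite box_nil.
rewrite box_cons => -[/= /andP[ax xb] /IH[l' l'x l'l]].
have [a] := rat_in_itvoo ax; rewrite inE /= => /andP[aa ax'].
have [b] := rat_in_itvoo xb; rewrite inE /= => /andP[xb' bb].
exists ((p.1.1, a, b) :: l'); first by rewrite box_cons; split => //=; apply/andP.
move=> y h; split; last by apply: l'l => r rl; apply: h; rewrite inE rl orbT.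
have /= /andP[ay yb] := h _ (mem_head _ _).
by apply/andP; split; [exact: lt_le_trans ay|exact: le_lt_trans bb].
Qed.

Definition box_open : set (set X) :=
  [set U | forall x, U x -> exists2 l, box l x & box l `<=` U].

Lemma box_openT : box_open setT.
Proof. by move=> x _; exists [::] => //; rewrite box_nil. Qed.

Lemma box_openI : setI_closed box_open.
Proof.
move=> U V oU oV x [Ux Vx].
have [l lx lU] := oU x Ux; have [l' l'x l'V] := oV x Vx.
exists (l ++ l'); rewrite box_cat; first by split.
by move=> y [/lU Uy /l'V Vy].
Qed.

Lemma box_open_bigU (J : Type) (f : J -> set X) :
  (forall i, box_open (f i)) -> box_open (\bigcup_i f i).
Proof.
move=> of_ x [i _ fx]; have [l lx lf] := of_ i x fx.
by exists l => // y /lf fy; exists i.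
Qed.

Definition box_topology := Topology box_openT box_openI box_open_bigU.

Local Notation S := (topo_space box_topology).

Lemma open_box l : open (box l : set S).
Proof. by move=> x lx; exists l. Qed.

Lemma cvg_box (Y : Type) (G : set_system Y) (FG : Filter G) (f : Y -> S)
    (x : S) :
  (forall i, F i (f y) @[y --> G] --> F i x) -> f @ G --> x.
Proof.
move=> cF A; rewrite nbhsE => -[B [oB Bx] BA].
have [l lx lB] := oB _ Bx.
suff: \forall y \near G, box l (f y).
  by apply: filterS => y /lB /BA.
elim: l {lB} lx => [_|p l IH]; first by rewrite box_nil; exact: filterT.
rewrite box_cons => -[/= /andP[ax xb] lx].
apply: filterI; last exact: IH.
near=> y; apply/andP; split; near: y.
  by apply: (cvgr_gt _ (cF p.1.1)).
by apply: (cvgr_lt _ (cF p.1.1)).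
Unshelve. all: by end_near. Qed.

Lemma continuous_box i : continuous (F i : S -> R).
Proof.
move=> x A /nbhs_ballP[e /= e0 eA].
have [a] := @rat_in_itvoo R (F i x - e) (F i x) ltac:(by rewrite gtrBl).
rewrite inE /= => /andP[ea ax].
have [b] := @rat_in_itvoo R (F i x) (F i x + e) ltac:(by rewrite ltrDl).
rewrite inE /= => /andP[xb be].
rewrite /= nbhsE; exists (box [:: (i, a, b)]).
  by split; [exact: open_box|rewrite box_cons box_nil; split => //=; apply/andP].
rewrite box_cons => y [/= /andP[ay yb] _]; apply: eA.
rewrite /ball /= ltr_distlC; apply/andP; split.
  exact: lt_trans ay.
exact: lt_trans be.
Qed.

Lemma closed_closed_box l : closed (closed_box l : set S).
Proof.
rewrite (_ : closed_box l = \bigcap_(p in [set` l])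
    (F p.1.1 @^-1` `[ratr p.1.2, ratr p.2]%classic)).
  apply: closed_bigI => p _; apply: preimage_closed.
    by move=> x _; exact: continuous_box.
  exact: interval_closed.
apply/seteqP; split => x h p lp; rewrite /= ?in_itv /=; first exact: h.
by have := h p lp; rewrite /= in_itv.
Qed.

Lemma box_coarser (T : topology X) :
  (forall i, continuous (F i : topo_space T -> R)) ->
  forall U, box_open U -> topo_open T U.
Proof.
move=> cF U oU.
suff -> : U = \bigcup_(l in [set l | box l `<=` U]) box l.
  apply: (@bigcup_open (topo_space T)) => l _.
  elim: l => [|p l IH]; first by rewrite box_nil; exact: openT.
  rewrite box_cons; apply: openI => //.
  rewrite (_ : [set _ | _] = F p.1.1 @^-1` `]ratr p.1.2, ratr p.2[%classic).
    by apply: open_comp; [move=> x _; exact: cF|exact: interval_open].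
  by apply/seteqP; split => x; rewrite /= in_itv.
apply/seteqP; split => [x Ux|x [l lU /lU]//].
by have [l lx lU] := oU x Ux; exists l.
Qed.

End box_topology.

Lemma exists_natSinv_lt (R : realType) (e : R) :
  0 < e -> exists n, n.+1%:R^-1 < e.
Proof.
move=> e0; have [n _ h] := near_infty_natSinv_lt (PosNum e0).
by exists n; exact: (h n (leqnn n)).
Qed.

(* X is a quotient of the subset D of the space Y, up to a spacelike boundary:
   this covers both a bounded Lorentzian metric space with one of its
   admissible topologies and the quotient of the support of a measure. *)
Section admissible_box.
Context (R : realType) (Y : ptopologicalType) (s : Y -> Y -> R) (D : set Y).
Context (X : choiceType) (tau : X -> X -> R) (q : Y -> X).
Hypothesis s_continuous : continuous (fun p : Y * Y => s p.1 p.2).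
Hypothesis s_compact : forall e : R, 0 < e ->
  compact [set p : Y * Y | [/\ D p.1, D p.2 & e <= s p.1 p.2]].
Hypothesis tau_q : forall a b, D a -> D b -> tau (q a) (q b) = s a b.
Hypothesis q_surj :
  forall x, is_spacelike_boundary tau x \/ exists2 a, D a & q a = x.
Hypothesis tau_ge0 : forall x y, 0 <= tau x y.
Hypothesis tau_distinguishes : distinguishes tau.

Let sl a : continuous (s a).
Proof.
move=> b; apply: (@continuous_comp _ _ _ (fun b => (a, b)) (fun p => s p.1 p.2)).
  exact: pairl_continuous.
exact: s_continuous.
Qed.

Let sr b : continuous (s^~ b).
Proof.
move=> a; apply: (@continuous_comp _ _ _ (fun a => (a, b)) (fun p => s p.1 p.2)).
  exact: pairr_continuous.
exact: s_continuous.
Qed.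

Let far e : set Y :=
  [set a | D a /\ exists2 b, D b & e <= s a b \/ e <= s b a].

Let far_le (e e' : R) : e' <= e -> far e `<=` far e'.
Proof.
move=> ee a [Da [b Db h]]; split => //; exists b => //.
by case: h => h; [left|right]; exact: le_trans h.
Qed.

Let compact_far (e : R) : 0 < e -> compact (far e).
Proof.
move=> e0; have K := s_compact e0.
rewrite (_ : far e =
  fst @` [set p : Y * Y | [/\ D p.1, D p.2 & e <= s p.1 p.2]] `|`
  snd @` [set p : Y * Y | [/\ D p.1, D p.2 & e <= s p.1 p.2]]).
  apply: compactU; apply: continuous_compact => //;
  apply: continuous_subspaceT => p; [exact: cvg_fst|exact: cvg_snd].
apply/seteqP; split => a.
  by case=> Da [b Db [h|h]]; [left; exists (a, b)|right; exists (b, a)].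
by case=> -[[x y] /= [Dx Dy h] <-]; split => //; [exists y|exists x] => //;
  [left|right].
Qed.

(** By the tube lemma, [s a b] is close to [s a z] for [b] near [z], uniformly in [a] over the
    compact set [far e]; a finite subcover gives the net. Control over [far e] alone suffices,
    because each nonboundary point is the image of a far point once [e] is small. *)
Let compact_net (e : R) : 0 < e -> exists zs : seq Y,
  (forall z, z \in zs -> D z) /\
  forall b, far e b -> exists2 z, z \in zs &
    forall a, far e a -> `|s a b - s a z| < e /\ `|s b a - s z a| < e.
Proof.
move=> e0; have K := compact_far e0.
pose good z := [set b |
  forall a, far e a -> `|s a b - s a z| < e /\ `|s b a - s z a| < e].
have near_good z : nbhs z (good z).
  have /compact_near_coveringP/(_ _ (nbhs z)
    (fun b a => `|s a b - s a z| < e /\ `|s b a - s z a| < e)) := K.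
  apply => a _.
  have c1 : (fun p : Y * Y => s p.1 p.2 - s p.1 z) @ (a, z) --> s a z - s a z.
    apply: cvgB; first exact: (@s_continuous (a, z)).
    by apply: (@cvg_comp _ _ _ fst (s^~ z)); [exact: cvg_fst|exact: sr].
  have c2 : (fun p : Y * Y => s p.2 p.1 - s z p.1) @ (a, z) --> s z a - s z a.
    apply: cvgB.
      apply: (@cvg_comp _ _ _ (fun p => (p.2, p.1)) (fun p => s p.1 p.2) _ (nbhs (z, a))).
        by apply: cvg_pair; [exact: cvg_snd|exact: cvg_fst].
      exact: (@s_continuous (z, a)).
    by apply: (@cvg_comp _ _ _ fst (s z)); [exact: cvg_fst|exact: sl].
  rewrite subrr in c1; rewrite subrr in c2.
  move/cvgr0_norm_lt : c1 => /(_ _ e0) c1; move/cvgr0_norm_lt : c2 => /(_ _ e0) c2.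
  by apply: filterS (filterI c1 c2) => -[].
have := K; rewrite compact_cover => /(_ Y (far e) (fun z => (good z)^°)).
case=> [z _|b fb|zs zsfar zscover]; first exact: open_interior.
  by exists b => //; exact: near_good.
exists (finmap.enum_fset zs); split => [z /zsfar|b /zscover[z zzs /interior_subset]].
  by rewrite inE => -[].
by exists z.
Qed.

Let zs_ex n : exists zs : seq Y,
  (forall z, z \in zs -> D z) /\
  forall b, far n.+1%:R^-1 b -> exists2 z, z \in zs &
    forall a, far n.+1%:R^-1 a ->
      `|s a b - s a z| < n.+1%:R^-1 /\ `|s b a - s z a| < n.+1%:R^-1.
Proof. by apply: compact_net; rewrite invr_gt0. Qed.

Let boundary := is_spacelike_boundary tau.

Let tau_gt0_boundary x y : 0 < tau x y -> ~ boundary x /\ ~ boundary y.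
Proof. by move=> xy; split => h; move: xy; rewrite ?(h _).1 ?(h _).2 ltxx. Qed.

Let nonboundary x : ~ boundary x -> exists y, 0 < tau x y \/ 0 < tau y x.
Proof.
move=> nbx; apply: contrapT => /forallNP h; apply: nbx => y.
have /not_orP[/negP + /negP] := h y.
by rewrite -!leNgt => h1 h2; split; apply/le_anti; rewrite tau_ge0 andbT.
Qed.

Let nonboundary_far x : ~ boundary x ->
  exists2 e, 0 < e & exists2 a, far e a & q a = x.
Proof.
move=> nbx; have [y xy] := nonboundary nbx.
have nby : ~ boundary y by case: xy => /tau_gt0_boundary[].
have [//|[a Da ax]] := q_surj x; have [//|[b Db bx]] := q_surj y.
have {}xy : 0 < s a b \/ 0 < s b a by rewrite -!tau_q// ax bx.
case: xy => xy; [exists (s a b)|exists (s b a)] => //; exists a => //;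
  split => //; exists b => //; [left|right]; exact: lexx.
Qed.

Let far_or_boundary x : exists2 e : R, 0 < e &
  forall e', e' <= e -> boundary x \/ exists2 a, far e' a & q a = x.
Proof.
have [bx|nbx] := pselect (boundary x); first by exists 1 => // e' _; left.
have [e e0 [a fa ax]] := nonboundary_far nbx.
by exists e => // e' ee; right; exists a => //; exact: far_le fa.
Qed.

(** Sections of [tau] at the countably many net points approximate all other sections pointwise,
    hence separate points. Joint continuity of [tau] does not follow from continuity of these
    sections; it is recovered from compactness, separately from above and from below. *)
Lemma exists_admissible_box : exists F : (nat * nat * bool) -> X -> R,
  [/\ forall i, [\/ F i = cst 0, exists z, F i = tau^~ z | exists z, F i = tau z],
      forall x y, (forall i, F i x = F i y) -> x = y,
      admissible tau (box_topology F) &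
      forall a, D a -> q @ within D (nbhs a) --> (q a : topo_space (box_topology F))].
Proof.
have [zs zsP] := choice zs_ex.
(* The index names the net, the position in it and the argument of [tau] that is varied. Positions
   past the end of a net give the zero function, which does not affect the topology. *)
pose F (i : nat * nat * bool) (x : X) : R :=
  if onth (zs i.1.1) i.1.2 is Some z then
    if i.2 then tau x (q z) else tau (q z) x else 0.
have F_tau i : [\/ F i = cst 0, exists z, F i = tau^~ z | exists z, F i = tau z].
  rewrite /F; case: onth => [z|]; last by apply: Or31.
  by case: i.2; [apply: Or32|apply: Or33]; exists (q z).
have zF n z : z \in zs n -> exists j, F (n, j, true) = tau^~ (q z) /\
    F (n, j, false) = tau (q z).
  by move=> /onthP[j zj]; exists j; rewrite /F /= zj.
(* A single net point replaces [w] in its relations to [x] and to [y]. The scale [n] is fine enough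
   for each of the three points to be far or on the boundary, and on the boundary all values
   vanish. *)
have approx x y w (e : R) : ~ boundary w -> 0 < e -> exists n j z,
    [/\ D z, F (n, j, true) = tau^~ (q z), F (n, j, false) = tau (q z),
    `|tau x w - tau x (q z)| < e /\ `|tau w x - tau (q z) x| < e &
    `|tau y w - tau y (q z)| < e /\ `|tau w y - tau (q z) y| < e].
  move=> nbw e0.
  have [ex ex0 hx] := far_or_boundary x; have [ey ey0 hy] := far_or_boundary y.
  have [ew ew0 hw] := far_or_boundary w.
  have : 0 < Num.min (Num.min ex ey) (Num.min ew e).
    by rewrite !lt_min ex0 ey0 ew0 e0.
  move=> /exists_natSinv_lt[n]; rewrite !lt_min.
  move=> /andP[/andP[/ltW nx /ltW ny] /andP[/ltW nw ne]].
  have [//|[b fb bw]] := hw _ nw.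
  have [zsD /(_ b fb)[z zn hz]] := zsP n.
  have [j [Fj1 Fj2]] := zF n z zn.
  have Dz : D z by exact: zsD.
  have [Db _] := fb; exists n, j, z; split => //.
    have [bx|[a fa ax]] := hx _ nx.
      by rewrite !(bx _).1 !(bx _).2 subrr normr0.
    have [Da _] := fa; rewrite -ax -bw !tau_q//.
    by have [h1 h2] := hz a fa; split; exact: lt_trans ne.
  have [bx|[a fa ax]] := hy _ ny.
    by rewrite !(bx _).1 !(bx _).2 subrr normr0.
  have [Da _] := fa; rewrite -ax -bw !tau_q//.
  by have [h1 h2] := hz a fa; split; exact: lt_trans ne.
have F_sep x y : (forall i, F i x = F i y) -> x = y.
  move=> Fxy; apply: contrapT => /tau_distinguishes[w xyw].
  have nbw : ~ boundary w.
    by move=> bw; case: xyw; rewrite ?(bw x).1 ?(bw y).1 ?(bw x).2 ?(bw y).2.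
  have [d d0 dlt] : exists2 d, 0 < d &
      d <= `|tau x w - tau y w| \/ d <= `|tau w x - tau w y|.
    case: xyw => /eqP; rewrite -subr_eq0 -normr_gt0 => h.
      by exists `|tau x w - tau y w|; rewrite ?lexx; [|left].
    by exists `|tau w x - tau w y|; rewrite ?lexx; [|right].
  have [|n [j [z [Dz F1 F2 [x1 x2] [y1 y2]]]]] := approx x y w (d / 2) nbw.
    by rewrite divr_gt0.
  have e1 : tau x (q z) = tau y (q z) by have := Fxy (n, j, true); rewrite F1.
  have e2 : tau (q z) x = tau (q z) y by have := Fxy (n, j, false); rewrite F2.
  case: dlt; rewrite leNgt => /negP; apply.
    rewrite (_ : tau x w - tau y w = (tau x w - tau x (q z)) - (tau y w - tau y (q z))).
      by rewrite (splitr d) (le_lt_trans (ler_normB _ _))// ltrD.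
    by rewrite e1; ring.
  rewrite (_ : tau w x - tau w y = (tau w x - tau (q z) x) - (tau w y - tau (q z) y)).
    by rewrite (splitr d) (le_lt_trans (ler_normB _ _))// ltrD.
  by rewrite e2; ring.
pose S := topo_space (box_topology F).
have q_cont a : D a -> (q : Y -> S) @ within D (nbhs a) --> (q a : S).
  move=> Da; apply: cvg_box => -[[n j] b]; rewrite /F /=.
  case E : (onth (zs n) j) => [z|]; last exact: cvg_cst.
  have Dz : D z by apply: (zsP n).1; apply/onthP; exists j.
  rewrite !tau_q//.
  have h (f g : Y -> R) : (forall y, D y -> f y = g y) ->
      g @ nbhs a --> g a -> f @ within D (nbhs a) --> g a.
    move=> fg gc.
    apply: (@cvg_trans _ (g @ within D (nbhs a))); last first.
      by apply: (cvg_trans _ gc); apply: cvg_app; exact: cvg_within.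
    by apply: near_eq_cvg; apply: filterS (withinT _ _) => y Dy; rewrite fg.
  case: b; last by apply: (h _ (s z)); [move=> y Dy; rewrite tau_q|exact: sl].
  by apply: (h _ (s^~ z)); [move=> y Dy; rewrite tau_q|exact: sr].
have S_sep2 : hausdorff_space (S * S)%type.
  apply: (@hausdorff_of_separating R (S * S)%type ((nat * nat * bool) * bool)%type
    (fun i (p : S * S) => if i.2 then F i.1 p.1 else F i.1 p.2)).
    move=> [i []] /= p.
      by apply: (@cvg_comp _ _ _ fst (F i)); [exact: cvg_fst|exact: continuous_box].
    by apply: (@cvg_comp _ _ _ snd (F i)); [exact: cvg_snd|exact: continuous_box].
  move=> [x x'] [y y'] h; congr (_, _).
    by apply: F_sep => i; have := h (i, true).
  by apply: F_sep => i; have := h (i, false).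
pose qq (p : Y * Y) : S * S := (q p.1, q p.2).
have qq_compact K : compact K -> K `<=` D `*` D -> compact (qq @` K).
  move=> cK KD; apply: continuous_compact => //.
  apply/subspace_continuousP => -[a b] Kab; have [Da Db] := KD _ Kab.
  apply: (@cvg_pair _ S S (within K (nbhs (a, b))) (nbhs (q a : S))
    (nbhs (q b : S)) _ _ _ (fun p => q p.1) (fun p => q p.2)).
    apply: (@cvg_comp _ _ _ fst (q : Y -> S) _ (within D (nbhs a))); last exact: q_cont.
    move=> A hA; have h : \forall p \near ((a, b) : Y * Y), D p.1 -> A p.1.
      have hA' : nbhs a (fun y => D y -> A y) := hA.
      exact: (cvg_fst hA').
    by apply: filterS h => p h Kp; exact: (h (KD _ Kp).1).
  apply: (@cvg_comp _ _ _ snd (q : Y -> S) _ (within D (nbhs b))); last exact: q_cont.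
  move=> A hA; have h : \forall p \near ((a, b) : Y * Y), D p.2 -> A p.2.
    have hA' : nbhs b (fun y => D y -> A y) := hA.
      exact: (cvg_snd hA').
  by apply: filterS h => p h Kp; exact: (h (KD _ Kp).2).
have tau_compact (e : R) : 0 < e -> compact [set p : S * S | e <= tau p.1 p.2].
  move=> e0; rewrite (_ : [set _ | _] =
    qq @` [set p : Y * Y | [/\ D p.1, D p.2 & e <= s p.1 p.2]]).
    by apply: qq_compact; [exact: s_compact|move=> p []].
  apply/seteqP; split => [[x y] /= xy|_ [[a b] /= [Da Db ab] <-] /=]; last first.
    by rewrite tau_q.
  have [nbx nby] := tau_gt0_boundary (lt_le_trans e0 xy).
  have [//|[a Da ax]] := q_surj x; have [//|[b Db bx]] := q_surj y.
  by exists (a, b) => /=; [split => //; rewrite -tau_q// ax bx|rewrite /qq /= ax bx].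
(* Some net point is at positive separation from [x]; a strict lower bound on that separation is an
   open condition that already forces points to be far. *)
have far_nbhs (x : S) : ~ boundary x -> exists2 e : R, 0 < e &
    exists2 U : set S, open_nbhs x U & U `<=` q @` far e.
  move=> nbx; have [y xy] := nonboundary nbx.
  have nby : ~ boundary y by case: xy => /tau_gt0_boundary[].
  have [d d0 dxy] : exists2 d, 0 < d & d <= tau x y \/ d <= tau y x.
    by case: xy => xy; [exists (tau x y)|exists (tau y x)] => //; [left|right].
  have [|n [j [z [Dz F1 F2 [x1 x2] _]]]] := approx x x y (d / 2) nby.
    by rewrite divr_gt0.
  have {}dxy : d / 2 < tau x (q z) \/ d / 2 < tau (q z) x.
    move: x1 x2; rewrite !ltr_distlC => /andP[x1 _] /andP[x2 _].
    case: dxy => h; [left|right]; lra.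
  exists (d / 2); first by rewrite divr_gt0.
  have farU w : d / 2 < tau w (q z) \/ d / 2 < tau (q z) w -> (q @` far (d / 2)) w.
    move=> h; have nbw : ~ boundary w.
      have d2 : 0 < d / 2 by rewrite divr_gt0.
      by case: h => /(lt_trans d2)/tau_gt0_boundary[].
    have [//|[a Da aw]] := q_surj w; exists a => //; split => //; exists z => //.
    by rewrite -!tau_q// aw; case: h => /ltW h; [left|right].
  case: dxy => h.
    exists [set w | d / 2 < tau w (q z)]; last by move=> w h'; apply: farU; left.
    split => //; rewrite -[X in open X](_ : F (n, j, true) @^-1` `]d / 2, +oo[%classic = _).
      by apply: open_comp; [move=> w _; exact: continuous_box|exact: interval_open].
    by rewrite F1; apply/seteqP; split => w; rewrite /= in_itv /= andbT.
  exists [set w | d / 2 < tau (q z) w]; last by move=> w h'; apply: farU; right.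
  split => //; rewrite -[X in open X](_ : F (n, j, false) @^-1` `]d / 2, +oo[%classic = _).
    by apply: open_comp; [move=> w _; exact: continuous_box|exact: interval_open].
  by rewrite F2; apply/seteqP; split => w; rewrite /= in_itv /= andbT.
exists F; split => //; split => // -[x y].
apply/cvgrPdist_lt => e e0.
(* Superlevel sets are compact in a Hausdorff space, hence closed. *)
have up : \forall p \near ((x, y) : S * S), tau p.1 p.2 < tau x y + e.
  have pos : 0 < tau x y + e by rewrite ltr_wpDl.
  have /closed_openC o := compact_closed S_sep2 (tau_compact _ pos).
  have h : nbhs ((x, y) : S * S) (~` [set p : S * S | tau x y + e <= tau p.1 p.2]).
    by apply: open_nbhs_nbhs; split => //=; apply/negP; rewrite -ltNge ltrDl.
  by apply: filterS h => p /= /negP; rewrite -ltNge.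
(* If the bound is negative there is nothing to show. Otherwise both points have neighbourhoods
   inside images of far points, and the far pairs violating the bound form a compact set whose image
   is closed and misses [(x, y)]. *)
have low : \forall p \near ((x, y) : S * S), tau x y - e < tau p.1 p.2.
  have [xy0|xy0] := ltP (tau x y - e) 0.
    by near=> p; exact: lt_le_trans xy0 _.
  have [nbx nby] := @tau_gt0_boundary x y ltac:(by lra).
  have [e1 e10 [U [oU Ux] UK]] := far_nbhs x nbx.
  have [e2 e20 [V [oV Vy] VK]] := far_nbhs y nby.
  pose L := (far e1 `*` far e2) `&` [set p | s p.1 p.2 <= tau x y - e].
  have cL : compact L.
    apply: compact_closedI; first by apply: compact_setX; exact: compact_far.
    rewrite (_ : [set _ | _] = (fun p : Y * Y => s p.1 p.2) @^-1`
      `]-oo, (tau x y - e)]%classic).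
      apply: preimage_closed; last exact: interval_closed.
      by move=> p _; exact: s_continuous.
    by apply/seteqP; split => p; rewrite /= in_itv.
  have /closed_openC oL : closed (qq @` L).
    apply: compact_closed => //; apply: qq_compact => //.
    by move=> p [[[? _] [? _]] _].
  have nbhsU : nbhs ((x, y) : S * S) (U `*` V).
    by exists (U, V) => //=; split; exact: open_nbhs_nbhs.
  have nbhsL : nbhs ((x, y) : S * S) (~` (qq @` L)).
    apply: open_nbhs_nbhs; split => // -[[a b] [[[Da _] [Db _]] /= ab] [ax bx]].
    by move: ab; rewrite -tau_q// ax bx leNgt ltrBlDr ltrDl e0.
  apply: filterS (filterI nbhsU nbhsL) => -[u v] /= [[Uu Vv] nL].
  have [a fa au] := UK _ Uu; have [b fb bv] := VK _ Vv.
  rewrite ltNge; apply/negP => h; apply: nL; exists (a, b).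
    by have [Da _] := fa; have [Db _] := fb; split => //=; rewrite -tau_q// au bv.
  by rewrite /qq /= au bv.
near=> p; rewrite ltr_distlC; apply/andP; split; last by near: p.
by rewrite ltrBlDr -ltrBlDr; near: p.
Unshelve. all: by end_near. Qed.

End admissible_box.

Lemma topologyP (X : Type) (T T' : topology X) :
  topo_open T = topo_open T' -> T = T'.
Proof.
case: T T' => [u a b c] [u' a' b' c'] /= uu'.
move: a b c; rewrite uu' => a b c.
by rewrite (Prop_irrelevance a a') (Prop_irrelevance b b') (Prop_irrelevance c c').
Qed.

(** Every admissible topology makes the sections of [tau] continuous, hence contains the box
    topology, which is admissible itself. *)
Lemma coarsest_topologyE (R : realType) (X : choiceType) (tau : X -> X -> R)
    (I : countType) (F : I -> X -> R) :
  (forall i, [\/ F i = cst 0, exists z, F i = tau^~ z | exists z, F i = tau z]) ->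
  admissible tau (box_topology F) -> coarsest_topology tau = box_topology F.
Proof.
move=> Ftau adm; apply: topologyP; apply/seteqP; split => [U /(_ _ adm)//|U oU].
move=> T [cT _]; apply: (box_coarser (F := F)) => // i x.
case: (Ftau i) => [->|[z ->]|[z ->]]; first exact: cst_continuous.
  apply: (@continuous_comp _ _ _ (fun x : topo_space T => (x, z : topo_space T))
    (fun p => tau p.1 p.2)); last exact: cT.
  exact: pairr_continuous.
apply: (@continuous_comp _ _ _ (fun x : topo_space T => (z : topo_space T, x))
  (fun p => tau p.1 p.2)); last exact: cT.
exact: pairl_continuous.
Qed.

(** * Borel sets of second countable spaces *)

Lemma open_measurable_borel (X : ptopologicalType) (U : set X) :
  open U -> measurable (U : set (borel X)).
Proof. exact: sub_sigma_algebra. Qed.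

Lemma closed_measurable_borel (X : ptopologicalType) (U : set X) :
  closed U -> measurable (U : set (borel X)).
Proof.
move=> /closed_openC/open_measurable_borel; rewrite -[X in _ -> measurable X]setCK.
exact: measurableC.
Qed.

Lemma continuous_measurable_borel (X Y : ptopologicalType) (f : X -> Y) :
  continuous f -> measurable_fun setT (f : borel X -> borel Y).
Proof.
move=> cf; apply: (@measurability _ _ (borel X) (borel Y) setT f (@open Y)) => // _ [U oU <-].
rewrite setTI; apply: open_measurable_borel; exact: open_comp.
Qed.

Section box_borel.
Context (R : realType) (I : countType) (X : pointedType) (F : I -> X -> R).
Local Notation S := (topo_space (box_topology F)).

Lemma measurable_box l : measurable (box F l : set (borel S)).
Proof. by apply: open_measurable_borel; exact: open_box. Qed.

Lemma open_bigcup_box (U : set S) : open U ->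
  U = \bigcup_(l in [set l | box F l `<=` U]) box F l.
Proof.
move=> oU; apply/seteqP; split => [x Ux|x [l lU /lU]//].
by have [l lx lU] := oU x Ux; exists l.
Qed.

(** Continuity puts every pair of points in a product of boxes of small oscillation. Codes of other
    products become empty rectangles, for which the bound is vacuous. *)
Lemma rect_approx_box (t : X -> X -> R) :
  continuous (fun p : S * S => t p.1 p.2) -> @rect_approx R _ (borel S) t.
Proof.
move=> ct e e0.
pose good (p : seq (I * rat * rat) * seq (I * rat * rat)) := `[< forall x y x' y', box F p.1 x -> box F p.1 x' ->
  box F p.2 y -> box F p.2 y' -> `|t x y - t x' y'| <= e >].
pose A (p : option (seq (I * rat * rat) * seq (I * rat * rat))) :=
  if p is Some p then if good p then (box F p.1, box F p.2) else (set0, set0)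
  else (set0, set0).
exists (fun n => (A (unpickle n)).1), (fun n => (A (unpickle n)).2); split.
- move=> n; rewrite /A; case: (unpickle _) => [p|] //=; case: (good p) => //=.
  exact: measurable_box.
- move=> n; rewrite /A; case: (unpickle _) => [p|] //=; case: (good p) => //=.
  exact: measurable_box.
- move=> x y; have e20 : 0 < e / 2 by rewrite divr_gt0.
  have /cvgrPdist_lt/(_ _ e20) := ct (x, y).
  case=> -[U V] /= []; rewrite !nbhsE => -[U' [oU Ux] UU] [V' [oV Vy] VV] UVt.
  have [l lx lU] := oU _ Ux; have [l' l'y lV] := oV _ Vy.
  exists (pickle (l, l')); rewrite pickleK /A.
  suff -> : good (l, l') by [].
  apply/asboolP => /= x1 y1 x2 y2 lx1 lx2 ly1 ly2.
  have h1 := UVt (x1, y1) (conj (UU _ (lU _ lx1)) (VV _ (lV _ ly1))).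
  have h2 := UVt (x2, y2) (conj (UU _ (lU _ lx2)) (VV _ (lV _ ly2))).
  rewrite (_ : _ - _ = (t x y - t x2 y2) - (t x y - t x1 y1)); last by ring.
  by rewrite (splitr e) (le_trans (ler_normB _ _))// lerD// ltW.
- move=> n x y x' y'; rewrite /A; case: (unpickle _) => [p|] //.
  by case: (boolP (good p)) => [/asboolP h|_] //= ? ? ? ?; exact: h.
Qed.

(** The closed boxes inside [U] are countably many and exhaust it by [box_shrink], so finitely many
    of them catch all but [e] of the mass. *)
Lemma open_inner_closed (P : probability (borel S) R) (U : set S) (e : R) :
  open U -> 0 < e -> exists E : set S,
    [/\ closed E, E `<=` U & (P (U `\` E) < e%:E)%E].
Proof.
move=> oU e0.
pose E_ k : set S := if unpickle k is Some l then
  if `[< closed_box F l `<=` U >] then closed_box F l else set0 else set0.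
have cE_ k : closed (E_ k).
  rewrite /E_; case: (unpickle _) => [l|]; last exact: closed0.
  by case: ifP => _; [exact: closed_closed_box|exact: closed0].
pose E n : set S := \bigcup_(k < n) E_ k.
have cE n : closed (E n).
  by apply: closed_bigcup => //; exact: finite_II.
have EU n : E n `<=` U.
  move=> x [k _]; rewrite /E_; case: (unpickle _) => [l|//].
  by case: asboolP => // h /h.
have mE n : measurable (E n : set (borel S)) by exact: closed_measurable_borel.
have mU : measurable (U : set (borel S)) by exact: open_measurable_borel.
have [|||n hn] := @probability_exhaustion _ _ _ P (fun n => E n `|` ~` U) _ _ _ e e0.
- by move=> n; apply: measurableU => //; exact: measurableC.
- move=> i j ij; apply/subsetPset => x [[k /= ki h]|h]; [left|by right].
  by exists k => //=; exact: leq_trans ki ij.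
- apply/seteqP; split => // x _; have [Ux|nUx] := pselect (U x); last by exists 0%N => //; right.
  have [l lx lU] := oU _ Ux; have [l' l'x l'l] := box_shrink lx.
  exists (pickle l').+1 => //; left; exists (pickle l') => /=; first exact: ltnSn.
  rewrite /E_ pickleK; case: asboolP => [_|[]]; first exact: box_closed_box.
  by move=> y /l'l /lU.
- exists (E n); split => //; suff -> : U `\` E n = ~` (E n `|` ~` U) by [].
  by rewrite setCU setCK setIC -setDE.
Qed.

Lemma probability_null_boxes (P : probability (borel S) R)
    (G : set (seq (I * rat * rat))) :
  (forall l, G l -> P (box F l) = 0%E) -> P (\bigcup_(l in G) box F l) = 0%E.
Proof.
move=> G0.
pose B_ k : set (borel S) := if unpickle k is Some l then
  if `[< G l >] then box F l else set0 else set0.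
have mB k : measurable (B_ k).
  rewrite /B_; case: (unpickle _) => [l|//]; case: ifP => // _; exact: measurable_box.
have -> : \bigcup_(l in G) box F l = \bigcup_k B_ k.
  apply/seteqP; split => [x [l Gl lx]|x [k _]].
    by exists (pickle l) => //; rewrite /B_ pickleK; case: asboolP.
  by rewrite /B_; case: (unpickle _) => [l|//]; case: asboolP => // Gl lx; exists l.
apply: measure_negligible; first exact: bigcupT_measurable.
apply: negligible_bigcup => k; apply/negligibleP => //.
rewrite /B_; case: (unpickle _) => [l|]; last exact: measure0.
by case: asboolP => [/G0//|_]; exact: measure0.
Qed.

Lemma closed_support (P : probability (borel S) R) :
  closed [set x : S | forall U : set S, open U -> U x -> (0 < P U)%E].
Proof.
rewrite -openC; move=> x /= /existsNP[U /not_implyP[oU /not_implyP[Ux PU]]].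
have [l lx lU] := oU _ Ux; exists l => // y ly /= h.
by apply: PU; apply: h => //; exact: lU.
Qed.

(** The complement is the union of the null boxes, and there are only countably many boxes. *)
Lemma support_probability1 (P : probability (borel S) R) :
  P [set x : S | forall U : set S, open U -> U x -> (0 < P U)%E] = 1%E.
Proof.
set A := [set _ | _].
have mA : measurable (A : set (borel S)).
  by apply: closed_measurable_borel; exact: closed_support.
suff P0 : P (~` A) = 0%E.
  by rewrite -[A]setCK probability_setC ?P0 ?sube0//; exact: measurableC.
rewrite (_ : ~` A = \bigcup_(l in [set l | P (box F l) = 0%E]) box F l).
  exact: probability_null_boxes.
apply/seteqP; split => [x /existsNP[U /not_implyP[oU /not_implyP[Ux PU]]]|x].
  have [l lx lU] := oU _ Ux; exists l => //=; apply/eqP.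
  rewrite eq_le measure_ge0 andbT leNgt; apply/negP => Pl; apply: PU.
  apply: lt_le_trans Pl _; apply: le_measure => //; rewrite inE.
    exact: measurable_box.
  exact: open_measurable_borel.
move=> [l /= Pl lx] /(_ (box F l) (@open_box _ _ _ _ _) lx).
by rewrite Pl ltxx.
Qed.

End box_borel.

Lemma open_prod_measurable (R : realType) (I I' : countType) (X X' : pointedType)
    (F : I -> X -> R) (F' : I' -> X' -> R)
    (O : set (topo_space (box_topology F) * topo_space (box_topology F'))) :
  open O -> measurable (O : set (borel (topo_space (box_topology F)) *
                                 borel (topo_space (box_topology F')))).
Proof.
move=> oO.
rewrite (_ : O = \bigcup_(p in [set p | box F p.1 `*` box F' p.2 `<=` O])
  (box F p.1 `*` box F' p.2)).
  rewrite bigcup_mkcond; apply: countable_bigcupT_measurable => [|p].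
    exact: countableP.
  by case: ifP => // _; apply: measurableX; exact: measurable_box.
apply/seteqP; split => [[x y] Oxy|z [p pO /pO]//].
have := oO; rewrite openE => /(_ _ Oxy) [[U V] /= []].
rewrite !nbhsE => -[U' [oU Ux] UU] [V' [oV Vy] VV] UVO.
have [l lx lU] := oU _ Ux; have [l' l'y lV] := oV _ Vy.
exists (l, l') => //= -[x' y'] /= [/lU /UU Ux' /lV /VV Vy'].
exact: (UVO (x', y')).
Qed.

(** * The correspondence defined by an ideal of null sets *)

Section lorentzian_space.
Context (R : realType).

(** The last clause is regularity. Together with the compact superlevel sets it provides small
    compact neighbourhoods off the boundary. *)
Definition lorentzian (S : topologicalType) (t : S -> S -> R) :=
  [/\ forall x y, 0 <= t x y, continuous (fun p : S * S => t p.1 p.2),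
      forall e : R, 0 < e -> compact [set p : S * S | e <= t p.1 p.2],
      distinguishes t &
      forall x (U : set S), open U -> U x -> exists V C : set S,
        [/\ open V, V x, V `<=` C, closed C & C `<=` U]].

Definition far_points (S : topologicalType) (t : S -> S -> R) (e : R) : set S :=
  [set x | exists y, e <= t x y \/ e <= t y x].

Context (S : topologicalType) (t : S -> S -> R).
Hypothesis tL : lorentzian t.

Lemma compact_far_points e : 0 < e -> compact (far_points t e).
Proof.
have [_ _ tc _ _] := tL => e0.
rewrite (_ : far_points t e = fst @` [set p : S * S | e <= t p.1 p.2] `|`
  snd @` [set p : S * S | e <= t p.1 p.2]).
  apply: compactU; apply: continuous_compact; try exact: tc;
  apply: continuous_subspaceT => p; [exact: cvg_fst|exact: cvg_snd].
apply/seteqP; split => a.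
  by case=> b [h|h]; [left; exists (a, b)|right; exists (b, a)].
by case=> -[[x y] /= h <-]; [exists y; left|exists x; right].
Qed.

Lemma boundary_tau_gt0 x y : 0 < t x y ->
  ~ is_spacelike_boundary t x /\ ~ is_spacelike_boundary t y.
Proof. by move=> xy; split => h; move: xy; rewrite ?(h _).1 ?(h _).2 ltxx. Qed.

Lemma nonboundaryP x :
  ~ is_spacelike_boundary t x -> exists y, 0 < t x y \/ 0 < t y x.
Proof.
have [t0 _ _ _ _] := tL.
move=> nbx; apply: contrapT => /forallNP h; apply: nbx => y.
have /not_orP[/negP + /negP] := h y.
by rewrite -!leNgt => h1 h2; split; apply/le_anti; rewrite t0 andbT.
Qed.

Lemma nonboundary_nbhs x : ~ is_spacelike_boundary t x ->
  exists y e, [/\ 0 < e, ~ is_spacelike_boundary t y &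
    \forall z \near x & w \near y, e < t z w \/ e < t w z].
Proof.
have [t0 tcont _ _ _] := tL => /nonboundaryP[y xy].
have [nbx nby] : ~ is_spacelike_boundary t x /\ ~ is_spacelike_boundary t y.
  by case: xy => /boundary_tau_gt0[].
case: xy => h; exists y; [exists (t x y / 2)|exists (t y x / 2)]; split => //;
  rewrite ?divr_gt0//.
  have lt : t x y / 2 < t x y by lra.
  by apply: filterS (cvgr_gt _ (tcont (x, y)) _ lt) => -[z w] /=; left.
have c : (fun p : S * S => t p.2 p.1) @ (x, y) --> t y x.
  apply: (@cvg_comp _ _ _ (fun p : S * S => (p.2, p.1)) (fun p => t p.1 p.2)
    _ (nbhs (y, x))); last exact: (tcont (y, x)).
  by apply: cvg_pair; [exact: cvg_snd|exact: cvg_fst].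
have lt : t y x / 2 < t y x by lra.
by apply: filterS (cvgr_gt _ c _ lt) => -[z w] /=; right.
Qed.

(** A closed neighbourhood inside [W] is intersected with the compact set of [e]-far points, itself
    a neighbourhood of [x]. *)
Lemma nonboundary_compact_nbhs x (W : set S) : ~ is_spacelike_boundary t x ->
  open W -> W x -> exists V K : set S,
    [/\ open V, V x, V `<=` K, compact K & K `<=` W].
Proof.
have [_ _ _ _ reg] := tL => nbx oW Wx.
have [y [e [e0 nby nxy]]] := nonboundary_nbhs nbx.
have [V [C [oV Vx VC cC CW]]] := reg _ _ oW Wx.
have : nbhs x (far_points t e).
  have h : nbhs x [set z | e < t z y \/ e < t y z].
    exact: (@pairr_continuous S S y x _ nxy).
  apply: filterS h => z /= [h|h]; exists y; [left|right]; exact: ltW.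
rewrite nbhsE => -[U [oU Ux] UK].
exists (V `&` U), (C `&` far_points t e); split.
- exact: openI.
- by [].
- by move=> z [/VC Cz /UK].
- by rewrite setIC; apply: compact_closedI => //; exact: compact_far_points.
- by move=> z [/CW].
Qed.

Lemma lorentzian_ext x y : (forall z, ~ is_spacelike_boundary t z ->
  t x z = t y z /\ t z x = t z y) -> x = y.
Proof.
have [_ _ _ td _] := tL => h; apply: contrapT => /td[z hz].
have [bz|/h[e1 e2]] := pselect (is_spacelike_boundary t z); last first.
  by case: hz; rewrite ?e1 ?e2.
by case: hz; rewrite ?(bz x).1 ?(bz x).2 ?(bz y).1 ?(bz y).2.
Qed.

End lorentzian_space.

Section null_correspondence.
Context (R : realType).

(** The last clause is all that remains of small distortion: two rectangles that are not null
    contain points at which the time separations almost agree. *)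
Definition null_ideal (S S' : topologicalType) (t : S -> S -> R)
    (t' : S' -> S' -> R) (null : set (S * S') -> Prop) :=
  [/\ null set0, forall A B, A `<=` B -> null B -> null A,
      forall A B, null A -> null B -> null (A `|` B) &
      forall (e : R) (U V : set S) (U' V' : set S'), 0 < e ->
        open U -> open V -> open U' -> open V' ->
        ~ null (U `*` U') -> ~ null (V `*` V') ->
        exists x y x' y', [/\ U x /\ U' x', V y /\ V' y' &
          `|t x y - t' x' y'| <= e]].

Definition null_mass (S S' : topologicalType) (t : S -> S -> R)
    (null : set (S * S') -> Prop) :=
  forall x (V : set S), ~ is_spacelike_boundary t x -> open V -> V x ->
    exists2 K' : set S', compact K' & ~ null (V `*` K').

Definition null_rel (S S' : topologicalType) (null : set (S * S') -> Prop)
    (x : S) (x' : S') :=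
  forall (U : set S) (U' : set S'), open U -> U x -> open U' -> U' x' ->
    ~ null (U `*` U').

Context (S S' : topologicalType) (t : S -> S -> R) (t' : S' -> S' -> R).
Context (null : set (S * S') -> Prop).
Hypotheses (tL : lorentzian t) (t'L : lorentzian t').
Hypotheses (nI : null_ideal t t' null).
Local Notation G := (null_rel null).

(** The sets whose complement in [K * K'] is null form a filter, proper because [K * K'] is not
    null. A cluster point is a related pair, since a null rectangle around it would have its
    complement in the filter. *)
Lemma null_rel_compact (K : set S) (K' : set S') : compact K -> compact K' ->
  ~ null (K `*` K') -> exists x x', [/\ K x, K' x' & G x x'].
Proof.
have [n0 nS nU _] := nI => cK cK' nK.
pose F : set_system (S * S') := [set A | null ((K `*` K') `\` A)].
have FF : ProperFilter F.
  split; first by rewrite /F /= setD0.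
  split.
  - by rewrite /F /= setDT.
  - move=> A B FA FB; rewrite /F /= setDIr; exact: nU.
  - by move=> A B AB; apply: nS => p [Kp nBp]; split => // /AB.
have [|p [[Kp K'p] clp]] := compact_setX cK cK' FF.
  by rewrite /F /= setDv.
exists p.1, p.2; split => // U U' oU Up oU' U'p nUU.
have Fc : F (~` (U `*` U')).
  by apply: nS nUU => z [_ /contrapT].
have [|z [zn zU]] := clp _ (U `*` U') Fc; last exact: zn.
by exists (U, U') => //=; split; exact: open_nbhs_nbhs.
Qed.

Lemma nbhs_pair_open (T T' : topologicalType) (x : T) (y : T') (A : set (T * T')) :
  nbhs (x, y) A -> exists U V, [/\ open U /\ U x, open V /\ V y & U `*` V `<=` A].
Proof.
move=> [[U V] /= []]; rewrite !nbhsE => -[U' oU UU] [V' oV VV] UVA.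
exists U', V'; split => // -[a b] /= [/UU Ua /VV Vb].
exact: (UVA (a, b)).
Qed.

Lemma null_rel_isometry x x' y y' : G x x' -> G y y' -> t x y = t' x' y'.
Proof.
have [_ _ _ iso] := nI; have [_ tc _ _ _] := tL; have [_ t'c _ _ _] := t'L.
move=> Gx Gy; apply: contrapT => /eqP; rewrite -subr_eq0 -normr_gt0 => d0.
(* Three errors are to add up to less than the gap: continuity of [t], continuity of [t'], and the
   mismatch allowed by the ideal. *)
have e0 : 0 < `|t x y - t' x' y'| / 4 by rewrite divr_gt0.
have /cvgrPdist_lt/(_ _ e0)/nbhs_pair_open[U [V [[oU Ux] [oV Vy] UV]]] := tc (x, y).
have /cvgrPdist_lt/(_ _ e0)/nbhs_pair_open[U' [V' [[oU' Ux'] [oV' Vy'] UV']]] :=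
  t'c (x', y').
have [a [b [a' [b' [[Ua Ua'] [Vb Vb'] ab]]]]] :=
  iso _ _ _ _ _ e0 oU oV oU' oV' (Gx _ _ oU Ux oU' Ux') (Gy _ _ oV Vy oV' Vy').
have h1 := UV (a, b) (conj Ua Vb); have h2 := UV' (a', b') (conj Ua' Vb').
have : `|t x y - t' x' y'| <
    `|t x y - t' x' y'| / 4 + `|t x y - t' x' y'| / 4 + `|t x y - t' x' y'| / 4.
  rewrite [ltLHS](_ : _ = `|(t x y - t a b) - (t' x' y' - t' a' b') +
    (t a b - t' a' b')|); last by congr `|_|; ring.
  rewrite (le_lt_trans (ler_normD _ _))// ltr_leD//.
  by rewrite (le_lt_trans (ler_normB _ _))// ltrD.
by lra.
Qed.

Hypothesis nm : null_mass t null.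

Lemma null_rel_dense x (W : set S) : ~ is_spacelike_boundary t x ->
  open W -> W x -> exists y y', W y /\ G y y'.
Proof.
have [_ nS _ _] := nI => nbx oW Wx.
have [V [K [oV Vx VK cK KW]]] := nonboundary_compact_nbhs tL nbx oW Wx.
have [K' cK' nVK'] := nm nbx oV Vx.
have [|y [y' [Ky _ Gy]]] := null_rel_compact cK cK'.
  by apply: contra_not nVK'; apply: nS => -[a b] /= [/VK].
by exists y, y'; split => //; exact: KW.
Qed.

(** Density gives related points near [x] and a related pair [(z, z')] with [z] at separation more
    than [e] from all of them. By isometry their partners are [e]-far because of [z'], so they stay
    in one compact set. If [x] had no partner, compactness would give a neighbourhood of [x] without
    partners in that set, against density. *)
Lemma null_rel_total x : ~ is_spacelike_boundary t x -> exists x', G x x'.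
Proof.
move=> nbx; have [w [e [e0 nbw xw]]] := nonboundary_nbhs tL nbx.
have [U [V [[oU Ux] [oV Vw] UV]]] := nbhs_pair_open xw.
have [z [z' [Vz Gz]]] := null_rel_dense nbw oV Vw.
have farG y y' : U y -> G y y' -> far_points t' e y'.
  move=> Uy Gy; exists z'.
  rewrite -(null_rel_isometry Gy Gz) -(null_rel_isometry Gz Gy).
  by have [/ltW|/ltW] := UV (y, z) (conj Uy Vz); [left|right].
apply: contrapT => /forallNP noG.
have := compact_far_points t'L e0 => /compact_near_coveringP
  /(_ _ (nbhs x) (fun y y' => ~ G y y')) /=.
have cov y' : far_points t' e y' -> \forall y'' \near y' & y \near x, ~ G y y''.
  move=> _; have : ~ G x y' by exact: noG.
  move=> /existsNP[A /existsNP[A' /not_implyP[oA /not_implyP[Ax]]]].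
  move=> /not_implyP[oA' /not_implyP[A'y /contrapT nA]].
  exists (A', A) => /=; first by split; exact: open_nbhs_nbhs.
  by move=> [b a] /= [A'b Aa] /(_ A A' oA Aa oA' A'b).
move=> /(_ _ cov); rewrite near_simpl -[X in X -> _]/(nbhs x _) nbhsE => -[W [oW Wx] WG].
have [y [y' [[Wy Uy] Gy]]] := null_rel_dense nbx (openI oW oU) (conj Wx Ux).
exact: (WG y Wy y' (farG _ _ Uy Gy) Gy).
Qed.

End null_correspondence.

Lemma null_correspondence_bijection (R : realType) (S S' : topologicalType)
    (t : S -> S -> R) (t' : S' -> S' -> R) (null : set (S * S') -> Prop) i0 i0' :
  lorentzian t -> lorentzian t' -> null_ideal t t' null ->
  null_mass t null -> null_mass t' (fun A => null [set p | A (p.2, p.1)]) ->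
  is_spacelike_boundary t i0 -> is_spacelike_boundary t' i0' ->
  exists iota : S -> S',
    [/\ forall x y, t x y = t' (iota x) (iota y),
        forall x', exists x, iota x = x' &
        forall x x', null_rel null x x' -> x' = iota x].
Proof.
move=> tL t'L nI nm nm' bi0 bi0'.
have swap (A : set S) (A' : set S') :
    [set p : S * S' | (A' `*` A) (p.2, p.1)] = A `*` A'.
  by apply/seteqP; split => -[a b] /=; tauto.
have nI' : null_ideal t' t (fun A => null [set p | A (p.2, p.1)]).
  have [n0 nS nU iso] := nI; split => [//|A B AB|A B|].
  - by apply: nS => p /=; exact: AB.
  - exact: nU.
  - move=> e U V U' V' e0 oU oV oU' oV'; rewrite !swap => nUU nVV.
    have [x [y [x' [y' [[? ?] [? ?] h]]]]] :=
      iso e U' V' U V e0 oU' oV' oU oV nUU nVV.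
    by exists x', y', x, y; split => //; rewrite distrC.
have tot := null_rel_total tL t'L nI nm.
have tot' x' : ~ is_spacelike_boundary t' x' -> exists x, null_rel null x x'.
  move=> /(null_rel_total t'L tL nI' nm')[x Gx]; exists x => U U' oU Ux oU' Ux'.
  by have := Gx _ _ oU' Ux' oU Ux; rewrite swap.
have isoG := null_rel_isometry tL t'L nI.
(* Every nonboundary [z'] has a partner, so its separations from [x1] and [x2] are both read off at
   [x]. *)
have uniqG x x1 x2 : null_rel null x x1 -> null_rel null x x2 -> x1 = x2.
  move=> G1 G2; apply: (lorentzian_ext t'L) => z' /tot'[z Gz].
  by rewrite -!(isoG _ _ _ _ G1 Gz) -!(isoG _ _ _ _ G2 Gz) -!(isoG _ _ _ _ Gz G1)
    -!(isoG _ _ _ _ Gz G2).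
have bG x x' : null_rel null x x' ->
    is_spacelike_boundary t x <-> is_spacelike_boundary t' x'.
  move=> Gx; split => bx; apply: contrapT.
    move=> /(nonboundaryP t'L)[y' xy].
    have /tot'[y Gy] : ~ is_spacelike_boundary t' y'.
      by case: xy => /boundary_tau_gt0[].
    by case: xy; rewrite -?(isoG _ _ _ _ Gx Gy) -?(isoG _ _ _ _ Gy Gx)
      ?(bx y).1 ?(bx y).2 ltxx.
  move=> /(nonboundaryP tL)[y xy].
  have /tot[y' Gy] : ~ is_spacelike_boundary t y.
    by case: xy => /boundary_tau_gt0[].
  by case: xy; rewrite ?(isoG _ _ _ _ Gx Gy) ?(isoG _ _ _ _ Gy Gx)
    ?(bx y').1 ?(bx y').2 ltxx.
have ubdry (T : topologicalType) (s : T -> T -> R) a b : lorentzian s ->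
    is_spacelike_boundary s a -> is_spacelike_boundary s b -> a = b.
  move=> sL ba bb; apply: (lorentzian_ext sL) => z _.
  by rewrite (ba z).1 (ba z).2 (bb z).1 (bb z).2.
(* A boundary point may lack a partner. It is sent to [i0'], the only partner it could have by [bG]
   and [ubdry]. *)
have /choice[iota iotaP] x : exists x', if `[< is_spacelike_boundary t x >]
    then x' = i0' else null_rel null x x'.
  by case: asboolP => [_|/tot//]; exists i0'.
exists iota.
have iota0 x : is_spacelike_boundary t x -> iota x = i0'.
  by move=> bx; have := iotaP x; case: asboolP.
have iotaG x : ~ is_spacelike_boundary t x -> null_rel null x (iota x).
  by move=> bx; have := iotaP x; case: asboolP.
split.
- move=> x y; have [bx|nbx] := pselect (is_spacelike_boundary t x).
    by rewrite (iota0 _ bx) (bx _).1 (bi0' _).1.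
  have [yb|nby] := pselect (is_spacelike_boundary t y).
    by rewrite (iota0 _ yb) (yb _).2 (bi0' _).2.
  exact: isoG (iotaG _ nbx) (iotaG _ nby).
- move=> x'; have [bx|nbx] := pselect (is_spacelike_boundary t' x').
    by exists i0; rewrite iota0//; exact: (ubdry _ t').
  have [x Gx] := tot' _ nbx; exists x; apply: (uniqG x) => //; apply: iotaG.
  by move=> /(bG _ _ Gx).
- move=> x x' Gx; have [bx|nbx] := pselect (is_spacelike_boundary t x).
    by rewrite iota0//; apply: (ubdry _ t') => //; exact/(bG _ _ Gx).
  by apply: (uniqG x) => //; exact: iotaG.
Qed.

Lemma lorentzian_box (R : realType) (X : choiceType) (tau : X -> X -> R)
    (I : countType) (F : I -> X -> R) :
  (forall x y, 0 <= tau x y) -> distinguishes tau ->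
  admissible tau (box_topology F) ->
  @lorentzian R (topo_space (box_topology F)) tau.
Proof.
move=> tau0 taud [tauc tauK]; split => // x U oU Ux.
have [l lx lU] := oU x Ux; have [l' l'x l'l] := box_shrink lx.
exists (box F l'), (closed_box F l'); split => //.
- exact: open_box.
- exact: box_closed_box.
- exact: closed_closed_box.
- by move=> y /l'l /lU.
Qed.

Lemma hausdorff_box (R : realType) (X : choiceType) (I : countType)
    (F : I -> X -> R) :
  (forall x y, (forall i, F i x = F i y) -> x = y) ->
  hausdorff_space (topo_space (box_topology F)).
Proof.
move=> Fsep.
apply: (@hausdorff_of_separating R (topo_space (box_topology F)) I F) => //.
exact: continuous_box.
Qed.

(** The compact sets of points far at scale [1/(n+1)], with the boundary point added to each,
    increase to the whole space. *)
Lemma lorentzian_tight (R : realType) (S : ptopologicalType) (t : S -> S -> R)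
    (P : probability (borel S) R) (i0 : S) :
  lorentzian t -> hausdorff_space S -> is_spacelike_boundary t i0 ->
  forall e : R, 0 < e -> exists2 K : set S, compact K & (P (~` K) < e%:E)%E.
Proof.
move=> tL hS bi0 e e0.
pose K n : set S := far_points t n.+1%:R^-1 `|` [set i0].
have cK n : compact (K n).
  apply: compactU; last exact: compact_set1.
  by apply: compact_far_points => //; rewrite invr_gt0.
have [|||n hn] := @probability_exhaustion _ _ _ P K _ _ _ e e0.
- move=> n; apply: closed_measurable_borel; exact: compact_closed.
- move=> i j ij; apply/subsetPset => x [[y h]|h]; [left; exists y|by right].
  have ji : j.+1%:R^-1 <= i.+1%:R^-1 :> R by rewrite lef_pV2 ?posrE// ler_nat.
  by case: h => h; [left|right]; exact: le_trans ji h.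
- apply/seteqP; split => // x _.
  have [bx|nbx] := pselect (is_spacelike_boundary t x).
    exists 0%N => //; right; apply: (lorentzian_ext tL) => z _.
    by rewrite (bx z).1 (bx z).2 (bi0 z).1 (bi0 z).2.
  have [y [h|h]] := nonboundaryP tL nbx; have [n /ltW hn] := exists_natSinv_lt h.
    by exists n => //; left; exists y; left.
  by exists n => //; left; exists y; right.
- by exists (K n).
Qed.

(** * The null ideal of a sequence of couplings and transport of the measure *)

Section reconstruction.
Context (R : realType) (S S' : ptopologicalType) (t : S -> S -> R)
  (t' : S' -> S' -> R) (P : probability (borel S) R) (P' : probability (borel S') R)
  (pi : nat -> probability (borel S * borel S')%type R) (W : set_system nat).
Hypothesis piP : forall n A, measurable A -> pi n (fst @^-1` A) = P A.
Hypothesis piP' : forall n B, measurable B -> pi n (snd @^-1` B) = P' B.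
Hypothesis pid : forall n, ((pi n \x pi n)
  [set p | (n.+1%:R^-1 < `|t p.1.1 p.2.1 - t' p.1.2 p.2.2|)%R] <= n.+1%:R^-1%:E)%E.
Hypothesis mt : measurable_fun setT (fun p : borel S * borel S => t p.1 p.2).
Hypothesis mt' : measurable_fun setT (fun p : borel S' * borel S' => t' p.1 p.2).
Hypothesis UW : UltraFilter W.
Hypothesis Woo : \oo `<=` W.

Let PFW : ProperFilter W. Proof. exact: ultra_proper. Qed.
Local Existing Instance PFW.

(** The measurable superset makes this an ideal of arbitrary sets, as the filter in
    [null_rel_compact] demands. *)
Definition limit_null (A : set (borel S * borel S')) :=
  exists B, [/\ measurable B, A `<=` B &
    forall e : R, 0 < e -> W [set n | (pi n B < e%:E)%E]].

(** This is where [W] must be an ultrafilter: failure of convergence to 0 becomes a lower bound for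
    [W]-almost all [n], not just for infinitely many. *)
Let not_limit_null A : measurable A -> ~ limit_null A ->
  exists2 e : R, 0 < e & W [set n | (e%:E <= pi n A)%E].
Proof.
move=> mA nA; apply: contrapT => h; apply: nA; exists A; split => // e e0.
have [//|hW] := in_ultra_setVsetC [set n | (pi n A < e%:E)%E] UW.
exfalso; apply: h; exists e => //; apply: filterS hW => n /= /negP.
by rewrite -leNgt.
Qed.

Let open_rect (U : set S) (U' : set S') : open U -> open U' ->
  measurable (U `*` U' : set (borel S * borel S')).
Proof. by move=> oU oU'; apply: measurableX; exact: open_measurable_borel. Qed.

Lemma limit_null_ideal : @null_ideal R S S' t t' limit_null.
Proof.
split.
- exists set0; split => // e e0; apply: filterS (filterT : W setT) => n _ /=.
  by rewrite measure0 lte_fin.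
- by move=> A B AB [C [mC BC h]]; exists C; split => //; exact: subset_trans BC.
- move=> A B [C [mC AC hC]] [D [mD BD hD]]; exists (C `|` D); split.
  + exact: measurableU.
  + exact: setUSS.
  + move=> e e0; have e2 : 0 < e / 2 by rewrite divr_gt0.
    apply: filterS (filterI (hC _ e2) (hD _ e2)) => n /= [h1 h2].
    rewrite (splitr e) EFinD; apply: le_lt_trans (lteD h1 h2).
    by apply: (@probability_subU_le _ _ _ _ _ C D) => //; exact: measurableU.
- move=> e U V U' V' e0 oU oV oU' oV' nU nV.
  have mU := open_rect oU oU'; have mV := open_rect oV oV'.
  have [e1 e10 h1] := not_limit_null mU nU.
  have [e2 e20 h2] := not_limit_null mV nV.
  (* With [1/(n+1)] below [e], a failure on the whole product of rectangles would count as
     distortion beyond [1/(n+1)]; with it below [e1 * e2], such a set would be too heavy. *)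
  have d0 : 0 < Num.min e (e1 * e2) by rewrite lt_min e0 mulr_gt0.
  have h3 : W [set n | n.+1%:R^-1 < Num.min e (e1 * e2)].
    exact: (Woo (near_infty_natSinv_lt (PosNum d0))).
  have [n [[/= n1 n2]]] := filter_ex (filterI (filterI h1 h2) h3).
  rewrite /= lt_min => /andP[ne n12].
  apply: contrapT => noex.
  have sub : (U `*` U') `*` (V `*` V') `<=`
      [set p | n.+1%:R^-1 < `|t p.1.1 p.2.1 - t' p.1.2 p.2.2|].
    move=> [[x x'] [y y']] /= [[Ux Ux'] [Vy Vy']]; rewrite ltNge; apply/negP => h.
    by apply: noex; exists x, y, x', y'; split => //; exact: le_trans (ltW ne).
  have md : measurable ([set p | n.+1%:R^-1 <
      `|t p.1.1 p.2.1 - t' p.1.2 p.2.2|] :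
      set ((borel S * borel S') * (borel S * borel S'))).
    apply: (@measurable_distortion R _ _ _
      ((borel S * borel S') * (borel S * borel S'))%type (borel S) (borel S') t t'
      (fun p => p.1.1) (fun p => p.2.1) (fun p => p.1.2) (fun p => p.2.2)) => //;
      exact: measurableT_comp.
  have := pid n; rewrite leNgt => /negP; apply.
  apply: (@lt_le_trans _ _ (e1 * e2)%:E); first by rewrite lte_fin.
  apply: (@le_trans _ _ ((pi n \x pi n)%E ((U `*` U') `*` (V `*` V')))).
    by rewrite product_measure1E// EFinM; apply: lee_pmul => //; rewrite lee_fin ltW.
  by apply: le_measure; rewrite ?inE//; exact: measurableX.
Qed.

Hypothesis full : forall x (U : set S), ~ is_spacelike_boundary t x ->
  open U -> U x -> (0 < P U)%E.
Hypothesis full' : forall x (U : set S'), ~ is_spacelike_boundary t' x ->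
  open U -> U x -> (0 < P' U)%E.
Hypothesis tight : forall e : R, 0 < e ->
  exists2 K : set S, compact K & (P (~` K) < e%:E)%E.
Hypothesis tight' : forall e : R, 0 < e ->
  exists2 K : set S', compact K & (P' (~` K) < e%:E)%E.
Hypotheses (hS : hausdorff_space S) (hS' : hausdorff_space S').

Let mcompact (K : set S) : compact K -> measurable (K : set (borel S)).
Proof. by move=> cK; apply: closed_measurable_borel; exact: compact_closed. Qed.

Let mcompact' (K : set S') : compact K -> measurable (K : set (borel S')).
Proof. by move=> cK; apply: closed_measurable_borel; exact: compact_closed. Qed.

Let mfst (A : set (borel S)) : measurable A ->
  measurable (fst @^-1` A : set (borel S * borel S')).
Proof. exact: measurable_preimageT. Qed.

Let msnd (A : set (borel S')) : measurable A ->
  measurable (snd @^-1` A : set (borel S * borel S')).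
Proof. exact: measurable_preimageT. Qed.

(** Tightness leaves less than half of [P V] outside [K']. Were [V * K'] null, the other half would
    be lost as well at some index, although the marginal of [V] is constant in [n]. *)
Lemma limit_null_mass : @null_mass R S S' t limit_null.
Proof.
move=> x V nbx oV Vx; have mV := open_measurable_borel oV.
have PV0 := full nbx oV Vx.
have fV : P V \is a fin_num by exact: fin_num_measure.
have v0 : 0 < fine (P V) by rewrite fine_gt0// PV0/= ltey_eq fV.
have v20 : 0 < fine (P V) / 2 by rewrite divr_gt0.
have [K' cK' hK'] := tight' v20; have mK' := mcompact' cK'.
exists K' => // -[B [mB VB /(_ _ v20) hB]].
have [n /= nB] := filter_ex hB.
suff: (P V < P V)%E by rewrite ltxx.
rewrite -{2}(fineK fV) (splitr (fine (P V))) EFinD.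
apply: le_lt_trans (lteD nB hK').
rewrite -(piP n mV) -(piP' n (measurableC mK')).
apply: (@probability_subU_le _ _ _ (pi n) _ B (snd @^-1` ~` K')) => //.
- exact: mfst.
- by apply: msnd; exact: measurableC.
- move=> [a b] /= Va; have [Kb|nKb] := pselect (K' b); last by right.
  by left; apply: VB.
Qed.

Lemma limit_null_mass' :
  @null_mass R S' S t' (fun A => limit_null [set p | A (p.2, p.1)]).
Proof.
move=> x V nbx oV Vx; have mV := open_measurable_borel oV.
have PV0 := full' nbx oV Vx.
have fV : P' V \is a fin_num by exact: fin_num_measure.
have v0 : 0 < fine (P' V) by rewrite fine_gt0// PV0/= ltey_eq fV.
have v20 : 0 < fine (P' V) / 2 by rewrite divr_gt0.
have [K cK hK] := tight v20; have mK := mcompact cK.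
exists K => // -[B [mB VB /(_ _ v20) hB]].
have [n /= nB] := filter_ex hB.
suff: (P' V < P' V)%E by rewrite ltxx.
rewrite -{2}(fineK fV) (splitr (fine (P' V))) EFinD.
apply: le_lt_trans (lteD nB hK).
rewrite -(piP' n mV) -(piP n (measurableC mK)).
apply: (@probability_subU_le _ _ _ (pi n) _ B (fst @^-1` ~` K)) => //.
- exact: msnd.
- by apply: mfst; exact: measurableC.
- move=> [a b] /= Va; have [Ka|nKa] := pselect (K a); last by right.
  by left; apply: VB.
Qed.

Variable iota : S -> S'.
Hypothesis iota_rel : forall x x', @null_rel S S' limit_null x x' -> x' = iota x.
Hypothesis iota_cont : continuous iota.
Hypothesis inner : forall (U : set S) (e : R), open U -> 0 < e ->
  exists E : set S, [/\ closed E, E `<=` U & (P (U `\` E) < e%:E)%E].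
Hypothesis inner' : forall (U : set S') (e : R), open U -> 0 < e ->
  exists E : set S', [/\ closed E, E `<=` U & (P' (U `\` E) < e%:E)%E].

(* The couplings concentrate on the graph of iota along W. *)
Lemma off_graph_null (E : set S) (E' : set S') : closed E -> closed E' ->
  (forall x, E x -> ~ E' (iota x)) ->
  forall e : R, 0 < e -> W [set n | (pi n (E `*` E') < e%:E)%E].
Proof.
move=> cE cE' EE' e e0; have e3 : 0 < e / 3 by rewrite divr_gt0.
have [K cK hK] := tight e3; have [K' cK' hK'] := tight' e3.
(* A related pair in this compact rectangle would be of the form [(x, iota x)], which the hypothesis
   excludes. The rest of the rectangle is paid for by tightness, whence the thirds. *)
have nEK : limit_null ((E `&` K) `*` (E' `&` K')).
  apply: contrapT => /(null_rel_compact limit_null_ideal).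
  case=> [||x [x' [[Ex _] [E'x' _] /iota_rel xx']]].
  - by rewrite setIC; exact: compact_closedI.
  - by rewrite setIC; exact: compact_closedI.
  - by apply: (EE' x) => //; rewrite -xx'.
have [B [mB EB /(_ _ e3)]] := nEK; apply: filterS => n /= nB.
have mK := mcompact cK; have mK' := mcompact' cK'.
rewrite (_ : e = e / 3 + (e / 3 + e / 3)); last by lra.
rewrite !EFinD; apply: le_lt_trans (lteD nB (lteD hK hK')).
have mE := closed_measurable_borel cE; have mE' := closed_measurable_borel cE'.
have mKC := mfst (measurableC mK); have mKC' := msnd (measurableC mK').
apply: (@probability_subU_le _ _ _ (pi n) _ B (fst @^-1` (~` K) `|` snd @^-1` (~` K'))) => //.
- exact: measurableX.
- exact: measurableU.
- move=> [a b] /= [Ea Eb]; have [Ka|nKa] := pselect (K a); last by right; left.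
  have [Kb|nKb] := pselect (K' b); last by right; right.
  by left; apply: EB.
apply: (@probability_subU_le _ _ _ (pi n) _ (fst @^-1` (~` K)) (snd @^-1` (~` K'))) => //.
- exact: measurableU.
- by rewrite piP//; exact: measurableC.
- by rewrite piP'//; exact: measurableC.
Qed.

(** Mass over [U] that misses [U'] lies on [E * ~U'], with [E] closed in [U], up to the small [U]
    minus [E]. That rectangle is closed on both sides and off the graph. The reverse inequality
    exchanges the roles of the factors. *)
Lemma iota_open (U' : set S') : open U' -> P (iota @^-1` U') = P' U'.
Proof.
move=> oU'; set U := iota @^-1` U'.
have oU : open U by apply: open_comp => // x _; exact: iota_cont.
have mU := open_measurable_borel oU; have mU' := open_measurable_borel oU'.
apply/eqP; rewrite eq_le; apply/andP; split; apply/lee_addgt0Pr => e e0.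
- have e2 : 0 < e / 2 by rewrite divr_gt0.
  have [E [cE EU hE]] := inner oU e2; have mE := closed_measurable_borel cE.
  have [n /= hn] := filter_ex (off_graph_null cE (open_closedC oU')
    (fun x Ex nUx => nUx (EU x Ex)) e2).
  rewrite (splitr e) EFinD.
  have mX : measurable (E `*` ~` U' : set (borel S * borel S')).
    by apply: measurableX => //; exact: measurableC.
  have mUE := measurableD mU mE.
  apply: le_trans (leeD (lexx (P' U')) (leeD (ltW hn) (ltW hE))).
  rewrite -(piP n mU) -(piP' n mU') -(piP n mUE).
  apply: (@probability_subU_le _ _ _ (pi n) _ (snd @^-1` U')
    (E `*` ~` U' `|` fst @^-1` (U `\` E))) => //.
  + exact: mfst.
  + exact: msnd.
  + by apply: measurableU => //; exact: mfst.
  + move=> [a b] /= Ua; have [Ub|nUb] := pselect (U' b); first by left.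
    by right; have [Ea|nEa] := pselect (E a); [left|right].
  apply: (@probability_subU_le _ _ _ (pi n) _ (E `*` ~` U') (fst @^-1` (U `\` E))) => //.
    by apply: measurableU => //; exact: mfst.
  exact: mfst.
- have e2 : 0 < e / 2 by rewrite divr_gt0.
  have [E [cE EU hE]] := inner' oU' e2; have mE := closed_measurable_borel cE.
  have [n /= hn] := filter_ex (off_graph_null (open_closedC oU) cE
    (fun x nUx Ex => nUx (EU _ Ex)) e2).
  rewrite (splitr e) EFinD.
  have mX : measurable (~` U `*` E : set (borel S * borel S')).
    by apply: measurableX => //; exact: measurableC.
  have mUE := measurableD mU' mE.
  apply: le_trans (leeD (lexx (P U)) (leeD (ltW hn) (ltW hE))).
  rewrite -(piP n mU) -(piP' n mU') -(piP' n mUE).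
  apply: (@probability_subU_le _ _ _ (pi n) _ (fst @^-1` U)
    (~` U `*` E `|` snd @^-1` (U' `\` E))) => //.
  + exact: msnd.
  + exact: mfst.
  + by apply: measurableU => //; exact: msnd.
  + move=> [a b] /= Ub; have [Ua|nUa] := pselect (U a); first by left.
    by right; have [Ea|nEa] := pselect (E b); [left|right].
  apply: (@probability_subU_le _ _ _ (pi n) _ (~` U `*` E) (snd @^-1` (U' `\` E))) => //.
    by apply: measurableU => //; exact: msnd.
  exact: msnd.
Qed.

Lemma iota_measure (B : set (borel S')) :
  measurable B -> P (iota @^-1` B) = P' B.
Proof.
move=> mB; have miota := continuous_measurable_borel iota_cont.
have [Q QE] := pushforward_probability P miota.
rewrite -QE; apply: (@measure_unique _ R (borel S') (@open S') (fun=> setT) _ _ _ _ Q P') => //.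
- exact: openI.
- by move=> _; exact: openT.
- by apply/seteqP; split => // x _; exists 0%N.
- by move=> A oA; rewrite [LHS]QE; exact: iota_open.
- by move=> k; rewrite [ltLHS]probability_setT ltry.
Qed.

End reconstruction.

(** * Metric measure spaces and their models *)

Section coarsest_box.
Context (R : realType).

Definition boxed (X : choiceType) (tau : X -> X -> R) (F : nat * nat * bool -> X -> R) :=
  [/\ forall i, [\/ F i = cst 0, exists z, F i = tau^~ z | exists z, F i = tau z],
      forall x y, (forall i, F i x = F i y) -> x = y &
      admissible tau (box_topology F)].

Definition coarsest_space (X : pointedType) (tau : X -> X -> R) : ptopologicalType :=
  topo_space (coarsest_topology tau).

Lemma open_prod_measurable_borel (X X' : pointedType) (tau : X -> X -> R)
    (tau' : X' -> X' -> R) F F'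
    (O : set (coarsest_space tau * coarsest_space tau')) :
  boxed tau F -> boxed tau' F' -> open O ->
  measurable (O : set (borel (coarsest_space tau) * borel (coarsest_space tau'))).
Proof.
move=> [F1 _ F3] [F1' _ F3']; move: O; rewrite /coarsest_space.
rewrite (coarsest_topologyE F1 F3) (coarsest_topologyE F1' F3').
exact: open_prod_measurable.
Qed.

Context (X : pointedType) (tau : X -> X -> R) (F : nat * nat * bool -> X -> R).
Hypothesis tauF : boxed tau F.
Hypotheses (tau0 : forall x y, 0 <= tau x y) (taud : distinguishes tau).
Local Notation S := (coarsest_space tau).

Lemma boxedE : coarsest_topology tau = box_topology F.
Proof. by case: tauF => F1 _ F3; exact: coarsest_topologyE F1 F3. Qed.

Lemma boxed_continuous : continuous (fun p : S * S => tau p.1 p.2).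
Proof. by rewrite /coarsest_space boxedE; case: tauF => _ _ []. Qed.

Lemma boxed_lorentzian : @lorentzian R S tau.
Proof.
by rewrite /coarsest_space boxedE; apply: lorentzian_box => //; case: tauF.
Qed.

Lemma boxed_hausdorff : hausdorff_space S.
Proof. by rewrite /coarsest_space boxedE; apply: hausdorff_box; case: tauF. Qed.

Lemma boxed_measurable :
  measurable_fun setT (fun p : borel S * borel S => tau p.1 p.2).
Proof.
apply: (@measurability _ _ (borel S * borel S)%type R setT _ (@RGenOInfty.G R)).
  exact: RGenOInfty.measurableE.
move=> _ [_ [x ->] <-]; rewrite setTI.
apply: (open_prod_measurable_borel tauF tauF).
apply: open_comp; last exact: interval_open.
by move=> p _; exact: boxed_continuous.
Qed.

Lemma boxed_rect_approx : @rect_approx R _ (borel S) tau.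
Proof.
have := boxed_continuous; rewrite /coarsest_space boxedE.
exact: rect_approx_box.
Qed.

Lemma boxed_inner_closed (P : probability (borel S) R) (U : set S) (e : R) :
  open U -> 0 < e -> exists E : set S,
    [/\ closed E, E `<=` U & (P (U `\` E) < e%:E)%E].
Proof.
move: P U; rewrite /coarsest_space boxedE => P U; exact: open_inner_closed.
Qed.

Lemma boxed_support (P : probability (borel S) R) :
  closed [set x : S | forall U : set S, open U -> U x -> (0 < P U)%E] /\
  P [set x : S | forall U : set S, open U -> U x -> (0 < P U)%E] = 1%E.
Proof.
move: P; rewrite /coarsest_space boxedE => P; split; first exact: closed_support.
exact: support_probability1.
Qed.

Lemma boxed_cvg (Y : Type) (G : set_system Y) (FG : Filter G) (f : Y -> S) (x : S) :
  (forall z, tau (f y) z @[y --> G] --> tau x z) ->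
  (forall z, tau z (f y) @[y --> G] --> tau z x) -> f @ G --> x.
Proof.
move=> h1 h2; move: f x h1 h2; rewrite /coarsest_space boxedE => f x h1 h2.
apply: cvg_box => i; case: tauF => /(_ i) Fi _ _.
case: Fi => [->|[z ->]|[z ->]]; [exact: cvg_cst|exact: h1|exact: h2].
Qed.

End coarsest_box.

(** * Vanishing distortion and isometries *)

Section null_distortion.
Context (R : realType).

Definition null_distortion d1 d2 (T1 : measurableType d1) (T2 : measurableType d2)
    (P1 : probability T1 R) (t1 : T1 -> T1 -> R)
    (P2 : probability T2 R) (t2 : T2 -> T2 -> R) :=
  forall e, 0 < e -> coupled e P1 t1 P2 t2.

Lemma null_distortion_sym d1 d2 (T1 : measurableType d1) (T2 : measurableType d2)
    (P1 : probability T1 R) (t1 : T1 -> T1 -> R)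
    (P2 : probability T2 R) (t2 : T2 -> T2 -> R) :
  measurable_fun setT (fun p : T1 * T1 => t1 p.1 p.2) ->
  measurable_fun setT (fun p : T2 * T2 => t2 p.1 p.2) ->
  null_distortion P1 t1 P2 t2 -> null_distortion P2 t2 P1 t1.
Proof. by move=> m1 m2 c e e0; apply: coupled_sym => //; exact: c. Qed.

Lemma null_distortion_trans d1 d2 d3 (T1 : measurableType d1) (T2 : measurableType d2)
    (T3 : measurableType d3) (P1 : probability T1 R) (t1 : T1 -> T1 -> R)
    (P2 : probability T2 R) (t2 : T2 -> T2 -> R)
    (P3 : probability T3 R) (t3 : T3 -> T3 -> R) :
  measurable_fun setT (fun p : T1 * T1 => t1 p.1 p.2) ->
  measurable_fun setT (fun p : T2 * T2 => t2 p.1 p.2) ->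
  measurable_fun setT (fun p : T3 * T3 => t3 p.1 p.2) ->
  rect_approx t2 ->
  null_distortion P1 t1 P2 t2 -> null_distortion P2 t2 P3 t3 -> null_distortion P1 t1 P3 t3.
Proof.
move=> m1 m2 m3 t2a c12 c23 e e0; have e3 : 0 < e / 3 by rewrite divr_gt0.
rewrite (_ : e = e / 3 + e / 3 + e / 3); last by lra.
by apply: (coupled_trans (t2 := t2)) => //; [exact: c12|exact: c23].
Qed.

End null_distortion.

Lemma null_distortion_isometry (R : realType) (X X' : pointedType) (tau : X -> X -> R)
    (tau' : X' -> X' -> R) F F' i0 i0' :
  boxed tau F -> (forall x y, 0 <= tau x y) -> distinguishes tau ->
  is_spacelike_boundary tau i0 ->
  boxed tau' F' -> (forall x y, 0 <= tau' x y) -> distinguishes tau' ->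
  is_spacelike_boundary tau' i0' ->
  forall (P : probability (borel (coarsest_space tau)) R)
    (P' : probability (borel (coarsest_space tau')) R),
  (forall x (U : set (coarsest_space tau)), ~ is_spacelike_boundary tau x ->
     open U -> U x -> (0 < P U)%E) ->
  (forall x (U : set (coarsest_space tau')), ~ is_spacelike_boundary tau' x ->
     open U -> U x -> (0 < P' U)%E) ->
  @null_distortion R _ _ (borel (coarsest_space tau)) (borel (coarsest_space tau'))
    P tau P' tau' ->
  exists iota : borel (coarsest_space tau) -> borel (coarsest_space tau'),
    [/\ measurable_fun setT iota,
        forall x y, tau x y = tau' (iota x) (iota y) &
        forall B, measurable B -> P (iota @^-1` B) = P' B].
Proof.
move=> tF tau0 taud bi0 tF' tau'0 tau'd bi0' P P' full full' cl.
set S := coarsest_space tau; set S' := coarsest_space tau'.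
have /choice[pi piE] (n : nat) := cl n.+1%:R^-1 ltac:(by rewrite invr_gt0).
have [W [UW Woo]] := @ultraFilterLemma nat \oo _.
have tL := boxed_lorentzian tF tau0 taud.
have t'L := boxed_lorentzian tF' tau'0 tau'd.
have hS := boxed_hausdorff tF; have hS' := boxed_hausdorff tF'.
have mt := boxed_measurable tF; have mt' := boxed_measurable tF'.
have pi1 n A : measurable A -> pi n (fst @^-1` A) = P A.
  by case: (piE n) => h _ _; exact: h.
have pi2 n B : measurable B -> pi n (snd @^-1` B) = P' B.
  by case: (piE n) => _ h _; exact: h.
have pid n : ((pi n \x pi n)
    [set p | (n.+1%:R^-1 < `|tau p.1.1 p.2.1 - tau' p.1.2 p.2.2|)%R]
    <= n.+1%:R^-1%:E)%E by case: (piE n).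
have tight := lorentzian_tight P tL hS bi0.
have tight' := lorentzian_tight P' t'L hS' bi0'.
have nI := limit_null_ideal pid mt mt' UW Woo.
have nm := limit_null_mass pi1 pi2 UW full tight' hS'.
have nm' := limit_null_mass' pi1 pi2 UW full' tight hS.
have [iota [iso surj rel]] := null_correspondence_bijection tL t'L nI nm nm' bi0 bi0'.
(* Since [iota] is onto, each section of [tau'] composed with [iota] is a section of [tau], and
   convergence is tested on sections. *)
have iotac : continuous (iota : S -> S').
  move=> x; have h := boxed_cvg tF' (nbhs_filter (x : S)) (f := iota) (x := iota x).
  apply: h => z;
    have [y <-] := surj z.
    rewrite -iso (_ : (fun _ => _) = tau^~ y); last by apply/funext => w; rewrite -iso.
    apply: (@continuous_comp _ _ _ (fun x : S => (x, y : S)) (fun p => tau p.1 p.2)).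
      exact: pairr_continuous.
    exact: (boxed_continuous tF).
  rewrite -iso (_ : (fun _ => _) = tau y); last by apply/funext => w; rewrite -iso.
  apply: (@continuous_comp _ _ _ (fun x : S => (y : S, x)) (fun p => tau p.1 p.2)).
    exact: pairl_continuous.
  exact: (boxed_continuous tF).
exists iota; split => //; first exact: continuous_measurable_borel.
move=> B mB; apply: (iota_measure pi1 pi2 pid mt mt' UW Woo tight tight' hS hS' rel) => //.
- by move=> U e; exact: (boxed_inner_closed tF).
- by move=> U e; exact: (boxed_inner_closed tF').
Qed.

(** * The quotient model of a metric measure space *)

Section models.
Context (R : realType) (M : nblmms R).
Local Notation tau := (@blms_tau R M).
Local Notation m := (@nblmms_measure R M).
Local Notation S := (blms_space M).
Local Notation sptM := (@spt R M).

Lemma blms_boxed : exists F, boxed tau F.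
Proof.
have [T [Tc TK]] := @blms_topology R M.
have [|||||F [F1 F2 F3 _]] := @exists_admissible_box R (topo_space T) tau setT (blms_carrier M) tau id Tc.
- move=> e e0; rewrite (_ : [set _ | _] =
    [set p : topo_space T * topo_space T | e <= tau p.1 p.2]); first exact: TK.
  by apply/seteqP; split => p //= [].
- by [].
- by move=> x; right; exists x.
- exact: blms_tau_ge0.
- exact: blms_distinguishes.
- by exists F; split.
Qed.

Lemma closed_spt : closed (sptM : set S).
Proof. by have [F /boxed_support/(_ m)[]] := blms_boxed. Qed.

Lemma measurable_spt : measurable (sptM : set (borel S)).
Proof. exact: closed_measurable_borel closed_spt. Qed.

Lemma spt_probability1 : m (sptM) = 1%E.
Proof. by have [F /boxed_support/(_ m)[]] := blms_boxed. Qed.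

(** The quotient projection, extended to all of [M] by a default value. The complement of the
    support is null, so the measure does not see the choice; isometry and continuity are claimed on
    the support only. *)
Definition to_model (x : M) : model M :=
  match pselect (sptM x) with
  | left h => in_i0 (@quot_tau R M) (spt_proj (exist _ x (mem_set h)))
  | right _ => point
  end.

Lemma to_modelE (x : sptM) : to_model (val x) = in_i0 (@quot_tau R M) (spt_proj x).
Proof.
rewrite /to_model; case: pselect => [h|[]]; last exact: set_valP.
by congr (in_i0 _ (spt_proj _)); exact: val_inj.
Qed.

Lemma model_tau_to_model a b : sptM a -> sptM b ->
  model_tau (to_model a) (to_model b) = tau a b.
Proof.
move=> /mem_set sa /mem_set sb.
rewrite (to_modelE (exist _ a sa)) (to_modelE (exist _ b sb)).
by rewrite /model_tau tau_i0E quot_tauE.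
Qed.

Lemma to_model_surj (x : model M) :
  is_spacelike_boundary (@model_tau R M) x \/
  exists2 a, sptM a & to_model a = x.
Proof.
case: x => [[c|] h]; last by left => -[[y|] ?].
right; exists (val (repr (c : {eq_quot (@spt_sim_equiv R M)}%qT))).
  exact: set_valP.
rewrite to_modelE; apply: val_inj => /=; congr Some.
exact: reprK.
Qed.

Lemma model_tau_ge0 (x y : model M) : 0 <= model_tau x y.
Proof.
case: x y => [[c|] h] [[d|] k] //=; rewrite /model_tau /tau_i0 //=.
exact: blms_tau_ge0.
Qed.

(** The adjoined point is present only if the quotient has no boundary point, so every class then
    has a nonzero separation that tells it from [None]. *)
Lemma model_distinguishes : distinguishes (@model_tau R M).
Proof.
have noi0 (c : spt_quot M) : ~ has_spacelike_boundary (@quot_tau R M) ->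
    exists d : spt_quot M, quot_tau c d <> 0 \/ quot_tau d c <> 0.
  move=> /forallNP/(_ c)/existsNP[d /not_andP h]; exists d.
  by case: h => h; [left|right].
move=> x y; case: x => [[c|] h]; case: y => [[d|] k] xy.
- have /negP : ~ spt_sim (repr (c : {eq_quot (@spt_sim_equiv R M)}%qT))
      (repr (d : {eq_quot (@spt_sim_equiv R M)}%qT)).
    move=> cd; apply: xy; apply: val_inj => /=; congr Some.
    rewrite -(reprK (c : {eq_quot (@spt_sim_equiv R M)}%qT)).
    rewrite -(reprK (d : {eq_quot (@spt_sim_equiv R M)}%qT)).
    by apply/eqmodP.
  rewrite /spt_sim => /asboolPn/existsNP[z /not_andP hz].
  exists (in_i0 (@quot_tau R M) (spt_proj z)); rewrite /model_tau /tau_i0 /=.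
  rewrite -(reprK (c : {eq_quot (@spt_sim_equiv R M)}%qT)).
  rewrite -(reprK (d : {eq_quot (@spt_sim_equiv R M)}%qT)).
  by rewrite !quot_tauE; case: hz => hz; [left|right].
- have nb : ~ has_spacelike_boundary (@quot_tau R M) by move/asboolP: (k); exact.
  have [e he] := @noi0 c nb.
  by exists (in_i0 (@quot_tau R M) e).
- have nb : ~ has_spacelike_boundary (@quot_tau R M) by move/asboolP: (h); exact.
  have [e he] := @noi0 d nb.
  exists (in_i0 (@quot_tau R M) e); rewrite /model_tau /tau_i0 /=.
  by case: he => /nesym he; [left|right].
- by exfalso; apply: xy; exact: val_inj.
Qed.

Lemma model_boxed : exists F, boxed (@model_tau R M) F /\
  forall a : S, sptM a -> (to_model : S -> model_space M) @ within sptM (nbhs a)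
    --> (to_model a : model_space M).
Proof.
have [F0 MF] := blms_boxed.
have [||||||F [F1 F2 F3 F4]] := @exists_admissible_box R S tau (sptM) (model M)
  (@model_tau R M) to_model.
- exact: (boxed_continuous MF).
- move=> e e0; rewrite (_ : [set _ | _] = [set p : S * S | e <= tau p.1 p.2] `&`
    (fst @^-1` sptM `&` snd @^-1` sptM)).
    apply: compact_closedI.
      by have [_ _ h _ _] := boxed_lorentzian MF (@blms_tau_ge0 R M) (@blms_distinguishes R M);
        exact: h.
    apply: closedI.
      apply: (@preimage_closed (S * S)%type S fst) closed_spt => p _.
      exact: cvg_fst.
    apply: (@preimage_closed (S * S)%type S snd) closed_spt => p _.
    exact: cvg_snd.
  by apply/seteqP; split => p /=; [case|case=> ? []].
- exact: model_tau_to_model.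
- exact: to_model_surj.
- exact: model_tau_ge0.
- exact: model_distinguishes.
- exists F; split; first by split.
  by rewrite /model_space (coarsest_topologyE F1 F3).
Qed.

Lemma measurable_to_model :
  measurable_fun setT (to_model : borel S -> borel (model_space M)).
Proof.
have [F [_ Fc]] := model_boxed.
apply: (@measurability _ _ (borel S) (borel (model_space M)) setT _
  (@open (model_space M))) => // _ [U oU <-]; rewrite setTI.
(* Continuity within the support makes the preimage of [U] agree there with an open set; elsewhere
   [to_model] is constant, and only the position of [point] matters. *)
pose O := \bigcup_(V in [set V : set S | open V /\ V `&` sptM `<=` to_model @^-1` U]) V.
have oO : open O by apply: bigcup_open => V [].
have OE a : sptM a -> U (to_model a) <-> O a.
  move=> sa; split => [Ua|[V [oV VU] Va]]; last exact: VU.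
  have : nbhs (to_model a : model_space M) U by exact: open_nbhs_nbhs.
  move=> /(Fc a sa); rewrite /= /within /= nbhsE => -[V [oV Va] VU].
  by exists V => //; split => // b [Vb sb]; exact: VU.
have sptC a : ~ sptM a -> to_model a = point.
  by rewrite /to_model; case: pselect.
have mO := open_measurable_borel oO; have ms := measurable_spt.
have [Up|nUp] := pselect (U point).
  rewrite (_ : to_model @^-1` U = (sptM `&` O) `|` ~` sptM).
    by apply: measurableU; [exact: measurableI|exact: measurableC].
  apply/seteqP; split => a /=.
    have [sa Ua|sa] := pselect (sptM a); last by right.
    by left; split => //; exact/(OE a sa).
  by case=> [[sa /(OE a sa)]|/sptC ->].
rewrite (_ : to_model @^-1` U = sptM `&` O); first exact: measurableI.
apply/seteqP; split => a /=.
  have [sa Ua|sa] := pselect (sptM a); last by rewrite sptC.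
  by split => //; exact/(OE a sa).
by case=> sa /(OE a sa).
Qed.

Lemma model_measureE (B : set (borel (model_space M))) : measurable B ->
  model_measure B = m (to_model @^-1` B).
Proof.
move=> mB; have mB' := measurable_preimageT measurable_to_model mB.
have ms := measurable_spt.
have -> : model_measure B = m (to_model @^-1` B `&` sptM).
  rewrite /model_measure; congr (m _); apply/seteqP; split => [_ [x Bx <-]|x [Bx sx]].
    by split; [rewrite /= to_modelE|exact: set_valP].
  exists (exist _ x (mem_set sx)) => //=.
  by rewrite -to_modelE.
have h : m (~` sptM) = 0%E.
  by rewrite probability_setC// spt_probability1 subee.
apply/eqP; rewrite eq_le; apply/andP; split.
  by apply: le_measure; rewrite ?inE//; exact: measurableI.
rewrite -[leRHS]adde0; apply: (@probability_subU_le _ _ _ m _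
  (to_model @^-1` B `&` sptM) (~` sptM)) => //.
- exact: measurableI.
- exact: measurableC.
- by move=> a Ba; have [sa|sa] := pselect (sptM a); [left|right].
- by rewrite h.
Qed.

Lemma model_probability :
  exists mu : probability (borel (model_space M)) R,
    [/\ forall B, measurable B -> model_measure B = mu B,
        forall x (U : set (model_space M)),
          ~ is_spacelike_boundary (@model_tau R M) x ->
          open U -> U x -> (0 < mu U)%E &
        @null_distortion R _ _ (borel S) (borel (model_space M)) m tau mu (@model_tau R M)].
Proof.
have [F [MF Fc]] := model_boxed; have [F0 F0M] := blms_boxed.
have [mu muE] := pushforward_probability m measurable_to_model.
exists mu; split.
- by move=> B mB; rewrite model_measureE// muE.
- move=> x U nbx oU Ux; have [//|[a sa ax]] := to_model_surj x.
  have : nbhs (to_model a : model_space M) U.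
    by apply: open_nbhs_nbhs; split => //; rewrite ax.
  move=> /(Fc a sa); rewrite /= /within /= nbhsE => -[V [oV Va] VU].
  apply: (lt_le_trans (sa V oV Va)).
  have mV := open_measurable_borel oV; have ms := measurable_spt.
  have mU : measurable (to_model @^-1` U : set (borel S)).
    exact: (measurable_preimageT measurable_to_model (open_measurable_borel oU)).
  rewrite muE -[leRHS]adde0; apply: (@probability_subU_le _ _ _ m _
    (to_model @^-1` U) (~` sptM)) => //.
  + exact: measurableC.
  + by move=> b Vb; have [sb|sb] := pselect (sptM b); [left; exact: VU|right].
  + by rewrite probability_setC// spt_probability1 subee.
- apply: (@coupled_graph R _ _ (borel S) (borel (model_space M)) m tau mu
    (@model_tau R M) to_model (sptM)).
  + exact: (boxed_measurable F0M).
  + exact: (boxed_measurable MF).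
  + exact: measurable_to_model.
  + exact: measurable_spt.
  + exact: spt_probability1.
  + by move=> x y sx sy; rewrite model_tau_to_model.
  + by move=> B mB; rewrite muE.
Qed.

End models.

(** * The distortion distance on isomorphism classes *)

Section distortion_metric.
Context (R : realType).
Implicit Types M N : nblmms R.

Definition space_coupled (e : R) M N :=
  @coupled R e _ _ (borel (blms_space M)) (borel (blms_space N))
    (nblmms_measure M) (@blms_tau R M) (nblmms_measure N) (@blms_tau R N).

Lemma blms_measurable M :
  measurable_fun setT (fun p : borel (blms_space M) * borel (blms_space M) =>
    @blms_tau R M p.1 p.2).
Proof. by have [F MF] := blms_boxed M; exact: (boxed_measurable MF). Qed.

Lemma model_measurable M :
  measurable_fun setT (fun p : borel (model_space M) * borel (model_space M) =>
    @model_tau R M p.1 p.2).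
Proof. by have [F [MF _]] := model_boxed M; exact: (boxed_measurable MF). Qed.

Lemma coupling_coupled M N (pi : probability
    (borel (blms_space M * blms_space N)%type) R) (e : R) : coupling pi ->
  ((pi \x pi)%E (@distortion_gt R M N e) <= e%:E)%E -> space_coupled e M N.
Proof.
move=> [pi1 pi2] pie; set S := blms_space M; set S' := blms_space N.
have mf : measurable_fun setT (fun p : borel (S * S')%type =>
    (p.1, p.2) : (borel S * borel S')%type).
  apply: measurable_fun_pair; apply: continuous_measurable_borel => p.
    exact: cvg_fst.
  exact: cvg_snd.
have [pi' pi'E] := pushforward_probability pi mf.
exists pi'; split => [A mA|B mB|]; rewrite ?pi'E; [exact: pi1|exact: pi2|].
rewrite (product_pushforward (P := pi) mf)//.
apply: (@measurable_distortion R _ _ _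
  ((borel S * borel S') * (borel S * borel S'))%type (borel S) (borel S')
  (@blms_tau R M) (@blms_tau R N)
  (fun p => p.1.1) (fun p => p.2.1) (fun p => p.1.2) (fun p => p.2.2)) => //;
  by [exact: blms_measurable|exact: measurableT_comp].
Qed.

(** The direction that uses second countability: open sets of the product topology must be
    measurable for the product sigma-algebra. The opposite passage needs only continuous
    projections. *)
Lemma coupled_coupling M N (e : R) : space_coupled e M N ->
  exists2 pi : probability (borel (blms_space M * blms_space N)%type) R,
    coupling pi & ((pi \x pi)%E (@distortion_gt R M N e) <= e%:E)%E.
Proof.
move=> [pi [pi1 pi2 pie]]; set S := blms_space M; set S' := blms_space N.
have [F MF] := blms_boxed M; have [F' NF] := blms_boxed N.
have mf : measurable_fun setT (fun p : (borel S * borel S')%type =>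
    p : borel (S * S')%type).
  apply: (@measurability _ _ (borel S * borel S')%type (borel (S * S')%type) setT _
    (@open (S * S')%type)) => // _ [U oU <-]; rewrite setTI.
  exact: (open_prod_measurable_borel MF NF).
have [pi' pi'E] := pushforward_probability pi mf.
exists pi'.
  by split => A mA; rewrite /pushforward pi'E; [exact: pi1|exact: pi2].
rewrite (product_pushforward (P := pi) mf)//.
have m1 : measurable_fun setT (fun p : borel (S * S')%type => p.1 : borel S).
  by apply: (@continuous_measurable_borel (S * S')%type S fst) => p; exact: cvg_fst.
have m2 : measurable_fun setT (fun p : borel (S * S')%type => p.2 : borel S').
  by apply: (@continuous_measurable_borel (S * S')%type S' snd) => p; exact: cvg_snd.
apply: (@measurable_distortion R _ _ _
  (borel (S * S')%type * borel (S * S')%type)%type (borel S) (borel S')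
  (@blms_tau R M) (@blms_tau R N)
  (fun p => p.1.1) (fun p => p.2.1) (fun p => p.1.2) (fun p => p.2.2)) => //.
- exact: blms_measurable.
- exact: blms_measurable.
- exact: (measurableT_comp m1).
- exact: (measurableT_comp m1).
- exact: (measurableT_comp m2).
- exact: (measurableT_comp m2).
Qed.

(** Merging the infima over couplings and over [e] reduces all later estimates to [space_coupled],
    and no infimum has to be attained. *)
Lemma distortion_distanceE M N : distortion_distance M N =
  ereal_inf [set e%:E | e in [set e : R | 0 < e /\ space_coupled e M N]].
Proof.
apply/eqP; rewrite eq_le; apply/andP; split.
  apply: le_ereal_inf_tmp => _ [e [e0 /coupled_coupling[pi cpi pie]] <-].
  apply: (@le_trans _ _ (coupling_distortion pi)).
    by apply: ereal_inf_lbound; exists pi.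
  by apply: ereal_inf_lbound; exists e.
apply: le_ereal_inf_tmp => _ [pi cpi <-]; apply: le_ereal_inf_tmp => _ [e [e0 pie] <-].
by apply: ereal_inf_lbound; exists e => //; split => //; exact: coupling_coupled pie.
Qed.

Lemma measurable_space_distortion M N (e : R) :
  measurable [set p : (borel (blms_space M) * borel (blms_space N)) *
    (borel (blms_space M) * borel (blms_space N)) |
    e < `|@blms_tau R M p.1.1 p.2.1 - @blms_tau R N p.1.2 p.2.2|].
Proof.
apply: (@measurable_distortion R _ _ _
  ((borel (blms_space M) * borel (blms_space N)) *
   (borel (blms_space M) * borel (blms_space N)))%type
  (borel (blms_space M)) (borel (blms_space N)) (@blms_tau R M) (@blms_tau R N)
  (fun p => p.1.1) (fun p => p.2.1) (fun p => p.1.2) (fun p => p.2.2)) => //;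
  by [exact: blms_measurable|exact: measurableT_comp].
Qed.

Lemma space_coupled_le M N (e e' : R) :
  e <= e' -> space_coupled e M N -> space_coupled e' M N.
Proof.
move=> ee' [pi [pi1 pi2 pie]]; exists pi; split => //.
apply: le_trans (_ : (e%:E <= e'%:E)%E); last by rewrite lee_fin.
apply: le_trans pie; apply: le_measure; rewrite ?inE.
- exact: measurable_space_distortion.
- exact: measurable_space_distortion.
- by move=> p /=; exact: le_lt_trans.
Qed.

(** The independent coupling works, as no probability exceeds 1. This is what makes the distance
    finite. *)
Lemma space_coupled1 M N : space_coupled 1 M N.
Proof.
exists (nblmms_measure M \x nblmms_measure N)%E; split.
- move=> A mA; rewrite (_ : fst @^-1` A = A `*` setT); last first.
    by apply/seteqP; split => -[a b] //= [].
  rewrite [LHS]product_measure1E// [X in (_ * X)%E](probability_setT (nblmms_measure N)).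
  by rewrite mule1.
- move=> A mA; rewrite (_ : snd @^-1` A = setT `*` A); last first.
    by apply/seteqP; split => -[a b] //= [].
  rewrite [LHS]product_measure1E// [X in (X * _)%E](probability_setT (nblmms_measure M)).
  by rewrite mul1e.
- apply: probability_le1; exact: measurable_space_distortion.
Qed.

Lemma space_coupled_sym M N (e : R) : space_coupled e M N -> space_coupled e N M.
Proof. by apply: coupled_sym; exact: blms_measurable. Qed.

Lemma space_coupled_trans M N K (a b e : R) : 0 < e ->
  space_coupled a M N -> space_coupled b N K -> space_coupled (a + b + e) M K.
Proof.
move=> e0; apply: coupled_trans => //; try exact: blms_measurable.
by have [F NF] := blms_boxed N; exact: (boxed_rect_approx NF).
Qed.

(** Both directions reduce to the models, from which the spaces have vanishing distortion.
    Reconstruction of the isometry is carried out there because the models are certain to possess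
    boundary points. *)
Lemma isomorphicP M N :
  isomorphic M N <-> forall e : R, 0 < e -> space_coupled e M N.
Proof.
have [mu [muE mufull mucl]] := model_probability M.
have [nu [nuE nufull nucl]] := model_probability N.
have [FM MF] := blms_boxed M; have [FN NF] := blms_boxed N.
have [GM [MG _]] := model_boxed M; have [GN [NG _]] := model_boxed N.
have mM := @blms_measurable M; have mN := @blms_measurable N.
have mM' := @model_measurable M; have mN' := @model_measurable N.
split.
- move=> [iota [miota iso iotaE]].
  have h : @null_distortion R _ _ (borel (model_space M)) (borel (model_space N))
      mu (@model_tau R M) nu (@model_tau R N).
    apply: (@coupled_graph R _ _ (borel (model_space M)) (borel (model_space N))
      mu (@model_tau R M) nu (@model_tau R N) iota setT) => //.
    + exact: probability_setT.
    + move=> B mB; rewrite -nuE// -iotaE// /pushforward muE//.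
      exact: (measurable_preimageT miota mB).
  apply: (null_distortion_trans mM mM' mN (boxed_rect_approx MG) mucl).
  apply: (null_distortion_trans mM' mN' mN (boxed_rect_approx NG) h).
  exact: (null_distortion_sym mN mN' nucl).
- move=> cMN.
  have h : @null_distortion R _ _ (borel (model_space M)) (borel (model_space N))
      mu (@model_tau R M) nu (@model_tau R N).
    apply: (null_distortion_trans mM' mM mN' (boxed_rect_approx MF)).
      exact: (null_distortion_sym mM mM' mucl).
    exact: (null_distortion_trans mM mN mN' (boxed_rect_approx NF) cMN nucl).
  have [i0 bi0] := with_i0_boundary (@quot_tau R M).
  have [i0' bi0'] := with_i0_boundary (@quot_tau R N).
  have [iota [miota iso iotaE]] := null_distortion_isometry MG (@model_tau_ge0 R M)
    (@model_distinguishes R M) bi0 NG (@model_tau_ge0 R N)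
    (@model_distinguishes R N) bi0' mufull nufull h.
  exists iota; split => // B mB; rewrite nuE// /pushforward muE ?iotaE//.
  exact: (measurable_preimageT miota mB).
Qed.

Lemma distortion_distance_le M N (e : R) : 0 < e -> space_coupled e M N ->
  (distortion_distance M N <= e%:E)%E.
Proof.
by move=> e0 c; rewrite distortion_distanceE; apply: ereal_inf_lbound; exists e.
Qed.

Lemma distortion_distance_lt M N (e : R) :
  (distortion_distance M N < e%:E)%E -> space_coupled e M N.
Proof.
rewrite distortion_distanceE => /ereal_inf_lt[_ [e' [_ c] <-]].
by rewrite lte_fin => /ltW ee; exact: space_coupled_le c.
Qed.

Lemma distortion_distance_ge0 M N : (0 <= distortion_distance M N)%E.
Proof.
rewrite distortion_distanceE; apply: le_ereal_inf_tmp => _ [e [e0 _] <-].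
by rewrite lee_fin ltW.
Qed.

Lemma distortion_distance_fin_num M N : distortion_distance M N \is a fin_num.
Proof.
rewrite ge0_fin_numE ?distortion_distance_ge0//.
by apply: le_lt_trans (distortion_distance_le ltr01 (space_coupled1 M N)) (ltry _).
Qed.

Definition real_distortion M N : R := fine (distortion_distance M N).

Lemma real_distortionE M N : (real_distortion M N)%:E = distortion_distance M N.
Proof. by rewrite fineK// distortion_distance_fin_num. Qed.

Lemma real_distortion_ge0 M N : 0 <= real_distortion M N.
Proof. by rewrite -lee_fin real_distortionE distortion_distance_ge0. Qed.

Lemma real_distortion_le M N (e : R) : 0 < e -> space_coupled e M N ->
  real_distortion M N <= e.
Proof. by move=> e0 c; rewrite -lee_fin real_distortionE distortion_distance_le. Qed.

Lemma real_distortion_lt M N (e : R) :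
  real_distortion M N < e -> space_coupled e M N.
Proof.
by move=> h; apply: distortion_distance_lt; rewrite -real_distortionE lte_fin.
Qed.

Lemma real_distortion_sym M N : real_distortion M N = real_distortion N M.
Proof.
suff le M' N' : real_distortion M' N' <= real_distortion N' M'.
  by apply: le_anti; rewrite !le.
apply/ler_addgt0Pr => e e0; apply: real_distortion_le.
  by rewrite ltr_wpDl// real_distortion_ge0.
by apply: space_coupled_sym; apply: real_distortion_lt; rewrite ltrDl.
Qed.

Lemma real_distortion_trans M N K :
  real_distortion M K <= real_distortion M N + real_distortion N K.
Proof.
apply/ler_addgt0Pr => e e0; have e3 : 0 < e / 3 by rewrite divr_gt0.
rewrite (_ : _ + e = (real_distortion M N + e / 3) + (real_distortion N K + e / 3)
  + e / 3); last by field.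
have pos A B : 0 < real_distortion A B + e / 3.
  by rewrite ltr_wpDl// real_distortion_ge0.
apply: real_distortion_le; first by rewrite addr_gt0// addr_gt0// pos.
by apply: (space_coupled_trans (N := N) e3); apply: real_distortion_lt; rewrite ltrDl.
Qed.

Lemma real_distortion_eq0 M N : real_distortion M N = 0 <-> isomorphic M N.
Proof.
rewrite isomorphicP; split => [d0 e e0|c].
  by apply: real_distortion_lt; rewrite d0.
apply: le_anti; rewrite real_distortion_ge0 andbT; apply/ler_addgt0Pr => e e0.
by rewrite add0r; apply: real_distortion_le => //; exact: c.
Qed.

Lemma real_distortion_iso M N M' N' : isomorphic M N -> isomorphic M' N' ->
  real_distortion M M' = real_distortion N N'.
Proof.
move=> /real_distortion_eq0 MN /real_distortion_eq0 M'N'.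
have NM : real_distortion N M = 0 by rewrite real_distortion_sym MN.
have N'M' : real_distortion N' M' = 0 by rewrite real_distortion_sym M'N'.
have h1 := real_distortion_trans M N M'; have h2 := real_distortion_trans N N' M'.
have h3 := real_distortion_trans N M N'; have h4 := real_distortion_trans M M' N'.
by apply: le_anti; lra.
Qed.

Lemma isomorphic_refl M : isomorphic M M.
Proof.
apply/real_distortion_eq0; apply: le_anti; rewrite real_distortion_ge0 andbT.
have miota : measurable_fun setT (@id (borel (blms_space M))) by exact: measurable_id.
apply/ler_addgt0Pr => e e0; rewrite add0r; apply: real_distortion_le => //.
apply: (@coupled_graph R _ _ (borel (blms_space M)) (borel (blms_space M))
  _ (@blms_tau R M) _ (@blms_tau R M) id setT) => //; try exact: blms_measurable.
exact: probability_setT.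
Qed.

(** Symmetry and transitivity of isomorphy are read off the pseudometric, so no inverse isometry has
    to be shown measurable. *)
Lemma iso_classE M N : iso_class M = iso_class N <-> isomorphic M N.
Proof.
split => [MN|MN]; first by rewrite -/(iso_class M N) MN; exact: isomorphic_refl.
apply/funext => K; apply/propext; rewrite /iso_class -!real_distortion_eq0.
by rewrite (real_distortion_iso MN (isomorphic_refl K)).
Qed.

Definition representative (c : iso_classes R) : nblmms R :=
  projT1 (cid (iso_classesP c)).

Lemma representativeE (c : iso_classes R) :
  iso_classes_mem c = iso_class (representative c).
Proof. by rewrite /representative; case: cid. Qed.

Lemma iso_classes_eq (c c' : iso_classes R) :
  iso_classes_mem c = iso_classes_mem c' -> c = c'.
Proof.
case: c c' => [m p] [m' p'] /= mm'; move: p p'; rewrite mm' => p p'.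
by rewrite (Prop_irrelevance p p').
Qed.

End distortion_metric.

Unset Implicit Arguments.

Theorem theorem4p12 (R : realType) :
  (forall M N M' N' : nblmms R, isomorphic M N -> isomorphic M' N' ->
     distortion_distance M M' = distortion_distance N N') /\
  exists d : iso_classes R -> iso_classes R -> R,
    (forall M M' : nblmms R,
       (d (class_of M) (class_of M'))%:E = distortion_distance M M') /\
    is_metric d.
Proof.
have invariant (M N M' N' : nblmms R) : isomorphic M N -> isomorphic M' N' ->
    distortion_distance M M' = distortion_distance N N'.
  by move=> MN M'N'; rewrite -!real_distortionE (real_distortion_iso MN M'N').
split; first exact: invariant.
exists (fun c c' => real_distortion (representative c) (representative c')).
split; [|split].
- move=> M M'; rewrite real_distortionE; apply: invariant.
    by apply/iso_classE; rewrite -representativeE.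
  by apply/iso_classE; rewrite -representativeE.
- by move=> c c'; exact: real_distortion_ge0.
- move=> c c'; rewrite real_distortion_eq0 -iso_classE -!representativeE.
  by split => [/iso_classes_eq|->].
- by move=> c c'; exact: real_distortion_sym.
- by move=> c c' c''; exact: real_distortion_trans.
Qed.
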